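(* Let $f\in\mathbb{Z}[X,U]$ be primitive and irreducible with $\deg_X f=d_1\geq 1$ and $\deg_U f=d_2\geq 1$, and write $|d|=d_1d_2$. Then there is an absolute constant $c>0$ such that for all integers $B_1,B_2\geq 2$, the number of pairs $(x,t)\in\mathbb{Z}\times\mathbb{Q}$ with $|x|\leq B_1$, $H(t)\leq B_2$ and $f(x,t)=0$ is at most \[ c\,|d|^{\frac{9}{2}}B_1^{\frac{1}{2d_2}}B_2^{\frac{1}{d_1}}\log(B_1 B_2). \]
   Context: A polynomial over $\mathbb{Z}$ is primitive if the gcd of its coefficients is $1$. For $t\in\mathbb{Q}$ written as $t=a/b$ with $a,b$ coprime integers, $b>0$, the height is $H(t)=\max\{|a|,|b|\}$. *)

(* Defs.v *)
From mathcomp Require Export all_boot all_order all_algebra.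
From mathcomp Require Export finmap.
From mathcomp Require Export all_classical all_reals all_analysis.

Set Implicit Arguments.
Unset Strict Implicit.
Unset Printing Implicit Defensive.

Import Order.TTheory GRing.Theory Num.Theory.

Local Open Scope ring_scope.
Local Open Scope classical_set_scope.

(* MathComp's irreducible_poly (polydiv) uses pseudo-division, so over Z[U] it
   is irreducibility over the fraction field; this is irreducibility in the
   ring itself. *)
Definition ring_irreducible (A : unitRingType) (f : A) : Prop :=
  [/\ f != 0, f \isn't a GRing.unit &
      forall g h : A, f = g * h ->
        g \is a GRing.unit \/ h \is a GRing.unit].

(* Z[X,U] is {poly {poly int}} with the conventions of polyXY: X is the outer
   variable 'X and U is the inner variable 'Y, so f`_i`_j is the coefficient of
   X^i U^j, and sizeY f is 1 + the degree of f in U (if f != 0). *)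
Definition degX (f : {poly {poly int}}) : nat := (size f).-1.

Definition degU (f : {poly {poly int}}) : nat := (sizeY f).-1.

Definition primitive (f : {poly {poly int}}) : Prop :=
  \big[gcdn/0%N]_(i < size f) \big[gcdn/0%N]_(j < size f`_i) absz f`_i`_j = 1%N.

Definition eval (f : {poly {poly int}}) (x : int) (t : rat) : rat :=
  (map_poly (map_poly (intr : int -> rat)) f).[x%:Q, t].

Definition height (t : rat) : int := Num.max `|numq t| `|denq t|.

Definition solutions (f : {poly {poly int}}) (B1 B2 : int) : set (int * rat) :=
  [set p : int * rat |
     [/\ `|p.1| <= B1, height p.2 <= B2 & eval f p.1 p.2 = 0]].

(* Main.v *)
(* This is the p-adic determinant method.  Write t = a/b.  Let p be a prime with
   p not dividing b and df/du not vanishing mod p at a point; on the points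
   congruent to it mod p, Hensel's lemma makes a/b a polynomial in x modulo any
   power of p.  Hence, for s = D1 D2 such points, the determinant of the
   monomials x^i a^j b^(D2-1-j) with i < D1, j < D2 is, modulo p^(s(s-1)/2), a
   multiple of a Vandermonde determinant in the x's, hence divisible by
   p^(s(s-1)/2).  If this exceeds the archimedean bound, all these determinants
   vanish, some polynomial of bidegree (< D1, < D2) vanishes on the whole
   residue class, and a resultant bounds the class by d1 D2 + D1 d2 points.

   With T1 = B1^(1/d2) and T2 = B2^(1/d1), the box D2 = d2, D1 ~ log B2 needs
   p >> T1 and the box D1 = d1, D2 ~ log B1 needs p >> T2^2.  Since
   T1^(1/2) T2 >= min(T1, T2^2), one of them works as soon as
   p >> d1^2 d2^2 T1^(1/2) T2.

   A single prime suffices: Chebyshev's estimates give primes in (P, 4P] with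
   product at least 2^P, so on average over these primes at least half of the
   points are smooth mod p once 2^P exceeds the square of the integers that
   detect bad reduction.  Their size is controlled because either f is
   determined up to scaling by the points, and then its coefficients are minors
   of the matrix of monomials, or the points lie on a second curve of the same
   bidegree. *)

Require Import Defs.
From mathcomp Require Import perm zify ring lra.

Set Implicit Arguments.
Unset Strict Implicit.
Unset Printing Implicit Defensive.

(** * Primes in a short interval *)

(** By Legendre's formula the valuation is the sum over k of floor(2n/p^k) - 2 floor(n/p^k); each
    term is at most 1 and vanishes once p^k exceeds 2n. *)
Lemma pfactor_central_bin p n : prime p -> (0 < n)%N ->
  (p ^ logn p 'C(n.*2, n) <= n.*2)%N.
Proof.
move=> p_pr n_gt0; set t := trunc_log p n.*2.
have p_gt1 := prime_gt1 p_pr.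
have t_le : (p ^ t <= n.*2)%N by apply: trunc_logP => //; rewrite double_gt0.
apply: (leq_trans _ t_le); rewrite leq_exp2l //.
have binE : ('C(n.*2, n) * (n`! * n`!))%N = n.*2`!.
  by rewrite -[in RHS](@bin_fact _ n) -addnn ?leq_addr // addnK.
have logE : (logn p 'C(n.*2, n) + (\sum_(1 <= k < n.*2.+1) n %/ p ^ k).*2)%N =
    (\sum_(1 <= k < n.*2.+1) n.*2 %/ p ^ k)%N.
  rewrite -logn_fact // -binE !lognM ?muln_gt0 ?fact_gt0 ?bin_gt0 //; last by lia.
  congr (_ + _)%N; rewrite addnn logn_fact //; congr _.*2.
  rewrite [LHS](@big_cat_nat _ _ _ n.+1) //=; last by lia.
  rewrite [X in (_ + X)%N]big1_seq ?addn0 // => k; rewrite mem_index_iota => /andP[_ /andP[nk _]].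
  by rewrite divn_small // (ltn_trans nk) // ltn_expl.
have term k : (n.*2 %/ p ^ k <= (n %/ p ^ k).*2 + (p ^ k <= n.*2))%N.
  have pk : (0 < p ^ k)%N by rewrite expn_gt0 prime_gt0.
  case: (leqP (p ^ k) n.*2) => [_|lt]; last by rewrite divn_small.
  by rewrite -ltnS ltn_divLR //; have := ltn_ceil n pk; nia.
have le1 : (\sum_(1 <= k < n.*2.+1) n.*2 %/ p ^ k <=
    \sum_(1 <= k < n.*2.+1) (n %/ p ^ k).*2 + \sum_(1 <= k < n.*2.+1) (p ^ k <= n.*2))%N.
  by rewrite -big_split; apply: leq_sum => k _; apply: term.
have le2 : (\sum_(1 <= k < n.*2.+1) (p ^ k <= n.*2) <= t)%N.
  have tn : (t <= n.*2)%N by apply: leq_trans t_le; apply/ltnW/ltn_expl.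
  rewrite (@big_cat_nat _ _ _ t.+1) //=.
  rewrite [X in (_ + X)%N]big1_seq ?addn0 => [|k].
    rewrite -[leqRHS](subnK (leqnn t)) -[leqRHS]muln1 subnn add0n -[in leqRHS](subn0 t) -subSS.
    by rewrite -sum_nat_const_nat; apply: leq_sum => k _; apply: leq_b1.
  rewrite mem_index_iota => /andP[_ /andP[tk _]]; case: (leqP (p ^ k) n.*2) => // pk.
  by have := trunc_log_max p_gt1 pk; rewrite leqNgt tk.
have dbl : (\sum_(1 <= k < n.*2.+1) (n %/ p ^ k).*2 =
    (\sum_(1 <= k < n.*2.+1) n %/ p ^ k).*2)%N.
  by rewrite -[RHS]mul2n big_distrr; apply: eq_bigr => k _; rewrite -[LHS]mul2n.
by move: le1; rewrite -logE dbl; lia.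
Qed.

Lemma sum_bin n : (\sum_(i < n.+1) 'C(n, i) = 2 ^ n)%N.
Proof. by rewrite -[2]/(1 + 1)%N expnDn; apply: eq_bigr => i _; rewrite !exp1n !muln1. Qed.

(** The two middle binomial coefficients are equal, and their sum is at most 2^(2m+1). *)
Lemma bin_odd_le m : ('C(m.*2.+1, m) <= 4 ^ m)%N.
Proof.
have mn : (m < m.*2.+1)%N by rewrite ltnS -addnn leq_addr.
have e : 'C(m.*2.+1, m.+1) = 'C(m.*2.+1, m).
  by rewrite -bin_sub //; congr 'C(_, _); lia.
have := sum_bin m.*2.+1.
rewrite (bigD1 (inord m)) //= inordK ?ltnS; last by lia.
rewrite (bigD1 (inord m.+1)) /=; last first.
  by rewrite -val_eqE /= !inordK ?ltnS; lia.
rewrite inordK ?ltnS; last by lia.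
rewrite e expnS -mul2n expnM -[2 ^ 2]/4; lia.
Qed.

Lemma prod_primes_dvd (r : seq nat) n : uniq r -> (forall p, p \in r -> prime p && (p %| n)) ->
  (\prod_(p <- r) p %| n)%N.
Proof.
elim: r => [|p r IH] /=; first by rewrite big_nil dvd1n.
move=> /andP[pr ur] h; rewrite big_cons Gauss_dvd.
  have /andP[_ ->] := h p (mem_head _ _).
  by apply: IH => // q qr; apply: h; rewrite inE qr orbT.
have /andP[p_pr _] := h p (mem_head _ _).
rewrite prime_coprime // Euclid_dvd_prod // big_has; apply/negP => /hasP [q qr] /=.
have /andP[q_pr _] : prime q && (q %| n) by apply: h; rewrite inE qr orbT.
by rewrite dvdn_prime2 // => /eqP pq; rewrite pq qr in pr.
Qed.

(** Erdos's induction: an even n above 2 adds no prime, and for n = 2m+1 the primes in (m+1, 2m+1]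
    all divide the binomial coefficient of [bin_odd_le]. *)
Lemma prod_primes_le n : (\prod_(0 <= p < n.+1 | prime p) p <= 4 ^ n)%N.
Proof.
elim/ltn_ind: n => n IH.
have [n2|n2] := leqP n 2; first by case: n n2 {IH} => [|[|[|]]] //; rewrite unlock.
have [nodd|neven] := boolP (odd n); last first.
  rewrite big_mkcond big_nat_recr //= ifF; last first.
    by apply: contraNF neven => np; case: (even_prime np) => // n_2; lia.
  rewrite -big_mkcond muln1; case: n n2 neven IH => // n n2 _ IH.
  by apply: leq_trans (IH n _) _; rewrite ?leq_exp2l.
set m := n./2; have nE : n = m.*2.+1 by rewrite -(odd_double_half n) nodd.
rewrite (@big_cat_nat _ _ _ m.+2) //=; last by lia.
rewrite [in leqRHS]nE -addnn -addSn expnD; apply: leq_mul; first by apply: IH; lia.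
apply: leq_trans (bin_odd_le m); rewrite -big_filter.
apply: dvdn_leq; first by rewrite bin_gt0; lia.
apply: prod_primes_dvd => [|p]; first by rewrite filter_uniq ?iota_uniq.
rewrite mem_filter mem_index_iota => /andP[p_pr /andP[mp pn]]; rewrite p_pr /=.
have : p %| n`! by rewrite dvdn_fact // prime_gt0 //=; lia.
rewrite -(@bin_fact n m) ?nE; last by lia.
rewrite !Euclid_dvdM // => /orP[//|].
have fact_lt k : (k < p)%N -> (p %| k`!) = false.
  move=> kp; rewrite fact_prod Euclid_dvd_prod // big_has; apply/hasP => -[i].
  by rewrite mem_index_iota => /andP[i1 ik] /dvdn_leq; lia.
by rewrite !fact_lt //; lia.
Qed.

Lemma central_bin_ge n : (0 < n)%N -> (4 ^ n <= n.*2 * 'C(n.*2, n))%N.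
Proof.
elim: n => // -[_ _|n IH _]; first by [].
have := IH isT; set k := n.+1 => h.
have e1 := mul_bin_diag k.*2.+2 k; have e2 := mul_bin_down k.*2.+1 k.
rewrite /= in e1 e2; rewrite doubleS expnS.
have e3 : (k.*2.+1 - k = k.+1)%N by lia.
rewrite e3 in e2; nia.
Qed.

Lemma prod_le_exp (I : Type) (r : seq I) (P : pred I) (F : I -> nat) M :
  (0 < M)%N -> (forall i, P i -> F i <= M)%N -> (\prod_(i <- r | P i) F i <= M ^ size r)%N.
Proof.
move=> M0 h; elim: r => [|i r IH] /=; first by rewrite big_nil.
rewrite big_cons expnS; case: ifP => Pi; first by rewrite leq_mul ?h.
by rewrite (leq_trans IH) // leq_pmull.
Qed.

Lemma leq_prod (I : Type) (r : seq I) (P : pred I) (F G : I -> nat) :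
  (forall i, P i -> F i <= G i)%N ->
  (\prod_(i <- r | P i) F i <= \prod_(i <- r | P i) G i)%N.
Proof. by move=> h; elim/big_ind2: _ => // *; apply: leq_mul. Qed.

(** With P = 4^k and M = 4P, factor the central binomial coefficient of M, which is at least
    4^(2P)/M. Primes up to Q = 2^(k+1) contribute at most M each, larger ones occur at most to the
    first power, and those in (Q, P] multiply to at most 4^P; what is left must come from (P,
    4P]. *)
Lemma prod_primes_window k : (6 <= k)%N ->
  (2 ^ (4 ^ k) <= \prod_(4 ^ k + 1 <= p < 4 ^ k.+1 + 1 | prime p) p)%N.
Proof.
move=> k6; set P := (4 ^ k)%N; set Q := (2 ^ k.+1)%N; set M := (4 ^ k.+1)%N.
have MQ : M = (Q ^ 2)%N by rewrite /M /Q -expnM mulnC expnM.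
have MP : M = (4 * P)%N by rewrite /M expnS.
have Pk : P = (2 ^ k * 2 ^ k)%N by rewrite /P -expnD addnn -mul2n expnM.
have k64 : (64 <= 2 ^ k)%N by rewrite -[64]/(2 ^ 6)%N leq_exp2l.
have QP : (Q <= P)%N by rewrite /Q expnS Pk leq_mul2r; lia.
pose n := (2 * P)%N; have nM : n.*2 = M by rewrite /n; lia.
have n0 : (0 < n)%N by rewrite /n; lia.
pose c := 'C(M, n).
have c0 : (0 < c)%N by rewrite bin_gt0 -nM -addnn leq_addr.
have cge : (4 ^ n <= M * c)%N by rewrite /c -nM central_bin_ge.
have pf p : prime p -> (p ^ logn p c <= M)%N by move=> pp; rewrite /c -nM pfactor_central_bin.
have cle : (c <= M ^ Q.+1 * (4 ^ P * \prod_(P + 1 <= p < M + 1 | prime p) p))%N.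
  have lK : (c <= maxn c M)%N by rewrite leq_maxl.
  rewrite -{1}(partnT c0) (widen_partn _ lK) /=.
  rewrite (@big_cat_nat _ _ _ Q.+1) //=; last by rewrite ltnS leq_max; lia.
  apply: leq_mul.
    apply: leq_trans (leq_trans _ (prod_le_exp (index_iota 0 Q.+1) (P := prime)
      (F := fun p => p ^ logn p c) _ pf)) _.
    - rewrite [leqRHS]big_mkcond; apply: leq_prod => p _; case: ifP => // /negbT np.
      by rewrite lognE (negbTE np).
    - by rewrite MP; lia.
    - by rewrite size_iota subn0.
  rewrite (@big_cat_nat _ _ _ M.+1) //=; [|by rewrite MP; lia|by rewrite ltnS leq_maxr].
  rewrite [X in (_ * X)%N]big1_seq ?muln1; last first.
    move=> p /andP[_]; rewrite mem_index_iota => /andP[Mp _].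
    have [pp|np] := boolP (prime p); last by rewrite lognE (negbTE np).
    have := pf p pp; case: (logn p c) => // l; rewrite expnS => h.
    have : (0 < p ^ l)%N by rewrite expn_gt0 prime_gt0.
    nia.
  apply: (@leq_trans (\prod_(Q.+1 <= p < M.+1 | prime p) p)%N).
    rewrite [leqRHS]big_mkcond /= big_seq_cond [leqRHS]big_seq_cond.
    apply: leq_prod => p; rewrite mem_index_iota andbT => /andP[Qp pM].
    case: ifP => [pp|/negbT np]; last by rewrite lognE (negbTE np).
    (* Here p > Q, so p^2 > M, and a valuation of 2 or more would contradict [pf]. *)
    have := pf p pp; have p0 := prime_gt0 pp; case: (logn p c) => [|[|l]] //; rewrite !expnS => h.
    have : (0 < p ^ l)%N by rewrite expn_gt0 prime_gt0.
    nia.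
  rewrite !addn1 (@big_cat_nat _ _ _ P.+1) //=; last by rewrite ltnS MP; lia.
  rewrite leq_mul2r; apply/orP; right; apply: leq_trans (prod_primes_le P).
  rewrite [leqRHS](@big_cat_nat _ _ _ Q.+1) //= leq_pmull //.
  by apply: prodn_cond_gt0 => p /prime_gt0.
set W := (\prod_(_ <= p < _ | _) p)%N in cle *.
have hM : M = (2 ^ (2 * k.+1))%N by rewrite /M expnM.
have : (2 ^ (4 * P) <= 2 ^ (2 * k.+1 * Q.+2 + 2 * P) * W)%N.
  rewrite -[(4 * P)%N]/(2 * 2 * P)%N -mulnA expnM -/n.
  apply: leq_trans cge _; apply: leq_trans (leq_mul (leqnn M) cle) _.
  rewrite expnD expnM -hM [(M ^ Q.+2)%N]expnS expnM -!mulnA.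
  by rewrite !leq_mul.
(* The error exponent has order k 2^k and is absorbed by P = 4^k. *)
have kk : (2 * k.+1 * Q.+2 <= P)%N.
  have k2 : (4 * k + 8 <= 2 ^ k)%N.
    elim: k k6 {P Q M MQ MP Pk k64 QP n nM n0 c c0 cge pf cle W hM} => // k IH.
    by rewrite leq_eqVlt => /orP[/eqP <- //|]; rewrite ltnS => /IH; rewrite expnS; lia.
  rewrite Pk /Q expnS; nia.
have -> : (4 * P = P + 3 * P)%N by lia.
rewrite expnD => h.
have h2 : (2 ^ (2 * k.+1 * Q.+2 + 2 * P) <= 2 ^ (3 * P))%N by rewrite leq_exp2l //; lia.
rewrite -(leq_pmul2r (_ : 0 < 2 ^ (3 * P))%N) ?expn_gt0 //.
by apply: leq_trans h _; rewrite mulnC leq_mul2l h2 orbT.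
Qed.

Import Order.TTheory GRing.Theory Num.Theory.

Local Open Scope ring_scope.

(** * Gauss's lemma in Z[X][U] and common zeros *)

(** This is exact divisibility in the ring, whereas [%|] between polynomials is divisibility up to a
    nonzero scalar. *)
Definition divides (A : pzSemiRingType) (d a : A) := exists q, a = q * d.

Definition prime_element (A : unitRingType) (p : A) :=
  [/\ p != 0, p \isn't a GRing.unit &
      forall a b, divides p (a * b) -> divides p a \/ divides p b].

Lemma int_unit_absz (z : int) : `|z|%N = 1%N -> z \is a GRing.unit.
Proof. by case: z => [[|[]]|[]] //. Qed.

Lemma divides_polyCz (z : int) (a : {poly int}) :
  divides z%:P a <-> (z %| zcontents a)%Z.
Proof.
rewrite dvdz_contents; split=> [[q ->]|/polyOver_dvdzP[q ->]].
  by apply/polyOver_dvdzP; exists q; rewrite mulrC mul_polyC.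
by exists q; rewrite mulrC mul_polyC.
Qed.

Lemma min_size_dvdp (c : {poly int}) : (1 < size c)%N ->
  exists d, [/\ d %| c, (1 < size d)%N &
    forall e, e %| d -> (1 < size e)%N -> (size d <= size e)%N].
Proof.
have [n le_n] := ubnP (size c); elim: n c le_n => // n IH c le_n c1.
have [[e [ec e1 lt]]|h] := pselect (exists e, [/\ e %| c, (1 < size e)%N & (size e < size c)%N]).
  have [||d [de d1 dmin]] := IH e => //; first by apply: leq_trans lt _; rewrite -ltnS.
  by exists d; split=> //; apply: dvdp_trans ec.
exists c; split=> // e ec e1; rewrite leqNgt; apply/negP => lt.
by apply: h; exists e.
Qed.

(** For nonconstant [c], a nonconstant divisor of least degree is irreducible over Q, and its
    primitive part is prime over Z by Gauss's lemma. For constant [c], a prime number dividing it is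
    prime in Z[X] because contents are multiplicative. *)
Lemma prime_divisor_int_poly (c : {poly int}) : c != 0 -> c \isn't a GRing.unit ->
  exists2 p, prime_element p & divides p c.
Proof.
move=> c0 cU; have [c1|c1] := ltnP 1 (size c).
  have [d [dc d1 dmin]] := min_size_dvdp c1; have d0 : d != 0 by rewrite -size_poly_gt0 ltnW.
  have [r cE] := dvdpP_int dc.
  exists (zprimitive d); last by exists r; rewrite mulrC.
  split=> [||a b [q abE]]; first by rewrite zprimitive_eq0.
    by rewrite poly_unitE size_zprimitive; case: eqP d1 => // ->.
  have zd : zprimitive d %= d.
    by rewrite {2}[d]zpolyEprim eqp_sym eqp_scale // zcontents_eq0.
  have dab : d %| a * b by rewrite -(eqp_dvdl _ zd) abE dvdp_mulIr.
  have sub x : d %| x -> divides (zprimitive d) x.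
    by move=> /dvdpP_int[s ->]; exists s; rewrite mulrC.
  have [co|nco] := boolP (coprimep d a).
    by right; apply: sub; rewrite -(Gauss_dvdpr _ co).
  left; apply: sub; have gd := dvdp_gcdl d a; have ga := dvdp_gcdr d a.
  suff /eqp_dvdl <- : gcdp d a %= d by [].
  rewrite -dvdp_size_eqp // eqn_leq (dvdp_leq d0 gd) dmin //.
  have : size (gcdp d a) != 0%N by rewrite size_poly_eq0 gcdp_eq0 negb_and d0.
  by move: nco; rewrite /coprimep; lia.
have [z cE] : exists z, c = z%:P by exists c`_0; apply: size1_polyC.
move: c0 cU; rewrite cE polyC_eq0 => z0.
rewrite poly_unitE size_polyC z0 coefC eqxx /= => zU.
have z1 : (1 < `|z|)%N.
  by rewrite ltn_neqAle absz_gt0 z0 andbT eq_sym; apply: contra zU => /eqP /int_unit_absz.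
set p := pdiv `|z|; have p_pr : prime p by apply: pdiv_prime.
exists (p%:Z)%:P; last first.
  apply/divides_polyCz; rewrite -alg_polyC zcontentsZ dvdzE abszM dvdn_mulr //.
  exact: pdiv_dvd.
split=> [||a b]; first by rewrite polyC_eq0 -absz_gt0 prime_gt0.
  rewrite poly_unitE coefC eqxx; apply/negP => /andP[_ /unitrP[x [xp _]]].
  have := congr1 absz xp; rewrite abszM => /eqP; rewrite muln_eq1 => /andP[_ /eqP p1].
  by move: p_pr; rewrite /= in p1; rewrite p1.
by rewrite !divides_polyCz zcontentsM !dvdzE abszM Euclid_dvdM // => /orP[]; [left|right].
Qed.

(** Gauss's argument: [p] divides the product of the leading coefficients, hence one of them;
    removing that leading term keeps the product divisible by [p] and lowers the total size. *)
Lemma prime_element_polyC (p : {poly int}) (g h : {poly {poly int}}) :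
  prime_element p -> divides p%:P (g * h) -> divides p%:P g \/ divides p%:P h.
Proof.
case=> p0 _ pP; have [n le_n] := ubnP (size g + size h)%N.
elim: n g h le_n => // n IH g h le_n [k ghE].
have [->|g0] := eqVneq g 0; first by left; exists 0; rewrite mul0r.
have [->|h0] := eqVneq h 0; first by right; exists 0; rewrite mul0r.
have drop (u : {poly {poly int}}) : u != 0 ->
    (size (u - (lead_coef u)%:P * 'X^((size u).-1))%R < size u)%N.
  move=> u0; rewrite -{2}(prednK (_ : 0 < size u)%N) ?size_poly_gt0 // ltnS.
  apply/leq_sizeP => j; rewrite leq_eqVlt => /orP[/eqP <-|lt].
    by rewrite coefB coefCM coefXn eqxx mulr1 lead_coefE subrr.
  rewrite coefB coefCM coefXn gtn_eqF // mulr0 subr0 nth_default //.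
  by rewrite -(prednK (_ : 0 < size u)%N) ?size_poly_gt0.
have : divides p (lead_coef g * lead_coef h).
  by exists (lead_coef k); rewrite -lead_coefM ghE lead_coefM lead_coefC.
have back (u : {poly {poly int}}) (q : {poly int}) : lead_coef u = q * p ->
    divides p%:P (u - (lead_coef u)%:P * 'X^((size u).-1)) -> divides p%:P u.
  move=> uq [r rE]; exists (r + q%:P * 'X^((size u).-1)).
  by rewrite mulrDl -rE uq polyCM; ring.
case/pP => -[q qE].
- have [||/(back _ _ qE) ?|?] := IH (g - (lead_coef g)%:P * 'X^((size g).-1)) h; [ | |by left|by right].
    by have := drop _ g0; move: le_n; rewrite ltnS; lia.
  exists (k - q%:P * 'X^((size g).-1) * h).
  by rewrite !mulrBl ghE qE polyCM; ring.
- have [||?|/(back _ _ qE) ?] := IH g (h - (lead_coef h)%:P * 'X^((size h).-1)); [ | |by left|by right].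
    by have := drop _ h0; move: le_n; rewrite ltnS; lia.
  exists (k - q%:P * 'X^((size h).-1) * g).
  by rewrite mulrBr mulrBl ghE qE polyCM; ring.
Qed.

(* Remove the prime divisors of c one at a time; each divides q or g. *)
Lemma gauss_factor (c : {poly int}) (P q g : {poly {poly int}}) : c != 0 ->
  c%:P * P = q * g -> exists c1 c2 q' g',
  [/\ c1 != 0, c2 != 0, q = c1%:P * q', g = c2%:P * g' & P = q' * g'].
Proof.
(* The measure drops with each prime factor: a nonconstant one lowers the degree, a constant one the
   leading coefficient. *)
have [n le_n] := ubnP (size c + `|lead_coef c|)%N.
elim: n c le_n q g => // n IH c le_n q g c0 cE.
have [cU|cU] := boolP (c \is a GRing.unit).
  exists c, 1, ((c^-1)%:P * q), g; split=> //; rewrite ?oner_neq0 ?mul1r //.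
    by rewrite mulrA -polyCM divrr // mul1r.
  by rewrite -mulrA -cE mulrA -polyCM mulVr // mul1r.
have [p pP [c' c'E]] := prime_divisor_int_poly c0 cU.
have [p0 pU _] := pP.
have c'0 : c' != 0 by apply: contra_neq c0 => z; rewrite c'E z mul0r.
have lt : (size c' + `|lead_coef c'| < n)%N.
  move: le_n; rewrite c'E size_mul // lead_coefM abszM.
  have lc0 : (0 < `|lead_coef c'|)%N by rewrite absz_gt0 lead_coef_eq0.
  have lp0 : (0 < `|lead_coef p|)%N by rewrite absz_gt0 lead_coef_eq0.
  have sc0 : (0 < size c')%N by rewrite size_poly_gt0.
  have [p1|p1] := leqP (size p) 1; last by nia.
  have pc := size1_polyC p1.
  have sp : size p = 1%N by apply/eqP; rewrite eqn_leq p1 size_poly_gt0.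
  have l2 : `|lead_coef p|%N != 1%N.
    apply: contra pU => /eqP /int_unit_absz; rewrite lead_coefE sp /= => u.
    by rewrite poly_unitE sp u.
  by rewrite sp; nia.
have pC0 : p%:P != 0 :> {poly {poly int}} by rewrite polyC_eq0.
have [|[k kE]|[k kE]] := prime_element_polyC (g := q) (h := g) pP.
- by exists (c'%:P * P); rewrite -cE c'E polyCM; ring.
- have [|c1 [c2 [q' [g' [c10 c20 kE' gE PE]]]]] := IH c' lt k g c'0.
    by apply: (mulfI pC0); rewrite mulrA -polyCM mulrC [p * _]mulrC -c'E mulrC cE kE; ring.
  exists (p * c1), c2, q', g'; split=> //; first by rewrite mulf_neq0.
  by rewrite kE kE' polyCM; ring.
- have [|c1 [c2 [q' [g' [c10 c20 qE kE' PE]]]]] := IH c' lt q k c'0.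
    by apply: (mulfI pC0); rewrite mulrA -polyCM mulrC [p * _]mulrC -c'E mulrC cE kE; ring.
  exists c1, (p * c2), q', g'; split=> //; first by rewrite mulf_neq0.
  by rewrite kE kE' polyCM; ring.
Qed.

Lemma unit_size1 (u : {poly {poly int}}) : u \is a GRing.unit -> size u = 1%N.
Proof. by rewrite poly_unitE => /andP[/eqP]. Qed.

(** A zero resultant gives a common factor of positive U-degree over Q(X). [gauss_factor] is used
    twice to clear denominators: once to see that this factor is [g] up to a scalar, once to bring
    the quotient of [P] by [g] back to Z[X][U]. *)
Lemma resultant_eq0_divides (g P : {poly {poly int}}) :
  ring_irreducible g -> (1 < size g)%N -> resultant g P = 0 -> divides g P.
Proof.
move=> [g0 gU gI] g1 /eqP; rewrite resultant_eq0; set d := gcdp g P => d1.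
have [[c q] /= c0 cE] := Pdiv.Idomain.dvdpP _ _ (dvdp_gcdl g P).
rewrite -/d -mul_polyC in cE.
have [c1 [c2 [q' [d' [c10 c20 qE dE gE]]]]] := gauss_factor c0 cE.
have sd : size d = size d' by rewrite dE mul_polyC size_scale.
have sq : size q' = 1%N.
  by case: (gI _ _ gE) => /unit_size1 // s; rewrite sd s in d1.
have q'0 : q' != 0 by rewrite -size_poly_gt0 sq.
have d'0 : d' != 0 by rewrite -size_poly_gt0 -sd; apply: ltn_trans d1.
have gd : g %| P.
  have := dvdp_gcdr g P; rewrite -/d => dP.
  have: d %= g.
    rewrite -dvdp_size_eqp ?dvdp_gcdl // gE size_mul // sq add1n /= sd //.
  by move=> /eqp_dvdl <-.
have [[e r] /= e0 eE] := Pdiv.Idomain.dvdpP _ _ gd; rewrite -mul_polyC in eE.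
have [e1 [e2 [r' [g' [e10 e20 rE g'E PE]]]]] := gauss_factor e0 eE.
case: (gI _ _ g'E) => [|/unit_size1 s]; last first.
  by move: g1; rewrite g'E mul_polyC size_scale // s.
move=> u; exists (r' * (e2%:P)^-1); rewrite g'E PE.
by rewrite -mulrA mulKr.
Qed.

Lemma size_prod_leq_sum (R : nzRingType) (I : Type) (r : seq I) (Q : pred I)
    (F : I -> {poly R}) (b : I -> nat) :
  (forall i, Q i -> (size (F i) <= (b i).+1)%N) ->
  (size (\prod_(i <- r | Q i) F i)%R <= (\sum_(i <- r | Q i) b i).+1)%N.
Proof.
move=> h; elim/big_ind2: _ => [|p m q n hp hq|]; first by rewrite size_poly1.
  by apply: leq_trans (size_polyMleq _ _) _; lia.
exact: h.
Qed.

Lemma size_det_leq (R : comNzRingType) n (A : 'M[{poly R}]_n) (b : 'I_n -> nat) :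
  (forall i j, size (A i j) <= (b i).+1)%N ->
  (size (\det A) <= (\sum_i b i).+1)%N.
Proof.
move=> h; apply: leq_trans (size_sum _ _ _) _; apply/bigmax_leqP => s _.
rewrite -signr_odd; case: (odd _); rewrite ?expr1 ?expr0 ?mulN1r ?mul1r ?size_polyN;
  by apply: size_prod_leq_sum => i _; apply: h.
Qed.

(** In the Sylvester matrix, deg q rows consist of coefficients of [p] and deg p rows of
    coefficients of [q]; each row contributes its largest inner degree. *)
Lemma size_resultant_leq (R : comNzRingType) (p q : {poly {poly R}}) :
  (size (resultant p q) <= ((sizeY p).-1 * (size q).-1 + (sizeY q).-1 * (size p).-1).+1)%N.
Proof.
pose b (i : 'I_((size q).-1 + (size p).-1)) :=
  if fintype.split i is inl _ then (sizeY p).-1 else (sizeY q).-1.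
have -> : ((sizeY p).-1 * (size q).-1 + (sizeY q).-1 * (size p).-1 = \sum_i b i)%N.
  rewrite big_split_ord /=; congr (_ + _)%N.
    rewrite (eq_bigr (fun=> (sizeY p).-1)) => [|i _]; last by rewrite /b (unsplitK (inl i)).
    by rewrite sum_nat_const card_ord mulnC.
  rewrite (eq_bigr (fun=> (sizeY q).-1)) => [|i _]; last by rewrite /b (unsplitK (inr i)).
  by rewrite sum_nat_const card_ord mulnC.
apply: size_det_leq => i j; rewrite Sylvester_mxE /b.
have co (u : {poly {poly R}}) k (c : bool) : (size (u`_k *+ c) <= (sizeY u).-1.+1)%N.
  case: c; rewrite ?mulr0n ?size_poly0 // mulr1n.
  by apply: leq_trans (max_size_coefXY u k) (leqSpred _).
by case: fintype.split => k; apply: co.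
Qed.

(* For P in Z[X][U] with U as the outer variable: X := x and U := t. *)
Definition biev (P : {poly {poly int}}) (x : int) (t : rat) : rat :=
  (map_poly (intr \o horner_eval x) P).[t].

Lemma bievD P Q x t : biev (P + Q) x t = biev P x t + biev Q x t.
Proof. by rewrite /biev rmorphD hornerD. Qed.

Lemma bievM P Q x t : biev (P * Q) x t = biev P x t * biev Q x t.
Proof. by rewrite /biev rmorphM hornerM. Qed.

Lemma bievC c x t : biev c%:P x t = (c.[x])%:~R.
Proof. by rewrite /biev map_polyC hornerC. Qed.

(** The polynomial is the resultant with respect to U: it lies in the ideal generated by [g] and
    [P], so it vanishes at their common zeros. If [P] does not involve U, its constant coefficient
    serves instead. *)
Lemma common_zeros (g P : {poly {poly int}}) e1 e2 :
    ring_irreducible g -> (1 < size g)%N -> ~ divides g P ->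
    (sizeY P <= e1.+1)%N -> (size P <= e2.+1)%N ->
  exists r : {poly int},
  [/\ r != 0, (size r <= ((sizeY g).-1 * e2 + e1 * (size g).-1).+1)%N
    & forall x t, biev g x t = 0 -> biev P x t = 0 -> root r x].
Proof.
move=> gI g1 gP Pe1 Pe2; have [P1|P1] := leqP (size P) 1.
  have PE := size1_polyC P1; exists P`_0; split.
  - by apply: contra_notN gP => /eqP P0; exists 0; rewrite PE P0 mul0r.
  - apply: leq_trans (leq_trans (max_size_coefXY P 0) Pe1) _; rewrite ltnS.
    have g1' : (0 < (size g).-1)%N by rewrite -subn1 subn_gt0.
    exact: (leq_trans (leq_pmulr e1 g1') (leq_addl _ _)).
  - by move=> x t _; rewrite {1}PE bievC => /eqP; rewrite intr_eq0.
exists (resultant g P); split.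
- by apply/eqP => h; apply: gP; apply: resultant_eq0_divides.
- apply: leq_trans (size_resultant_leq g P) _.
  rewrite ltnS leq_add // ?leq_mul2l ?leq_mul2r; apply/orP; right.
    by rewrite -subn1 leq_subLR.
  by rewrite -subn1 leq_subLR.
move=> x t gx Px; have [[u v] /= _ rE] := resultant_in_ideal g1 P1.
have /(congr1 (fun Q => biev Q x t)) := rE.
rewrite bievC bievD !bievM gx Px !mulr0 addr0 => /eqP.
by rewrite intr_eq0.
Qed.

(** * Integer determinants *)

(** Over Q, either the columns have full rank and a maximal minor is nonzero, or there is a rational
    kernel vector, whose denominators can be cleared. *)
Lemma int_kernel_or_minor m n (A : 'M[int]_(m, n)) :
  (exists2 c : 'cV[int]_n, c != 0 & A *m c = 0) \/
  (exists r : 'I_n -> 'I_m, \det (rowsub r A) != 0).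
Proof.
pose toQ k l (M : 'M[int]_(k, l)) : 'M[rat]_(k, l) := map_mx intr M.
have [full|nfull] := boolP (row_full (toQ _ _ A)).
  right; exists (fullrankfun full); have := fullrowsub_unit full.
  rewrite unitmxE unitfE; apply: contra_neq => d0.
  by rewrite -map_mxsub det_map_mx d0.
left; have : kermx (toQ _ _ A)^T != 0.
  rewrite -mxrank_eq0 mxrank_ker mxrank_tr subn_eq0 -ltnNge ltn_neqAle rank_leq_col andbT.
  exact: nfull.
case/rowV0Pn => v /sub_kermxP vA v0.
(* The vector is read as a polynomial so that [rat_poly_scale] supplies a common denominator. *)
have [q [a a0 qE]] := rat_poly_scale (rVpoly v).
have vE j : v 0 j = a%:~R^-1 * (q`_j)%:~R.
  by rewrite -[v]rVpolyK qE !mxE coefZ coef_map.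
have aQ : a%:~R != 0 :> rat by rewrite intr_eq0.
exists (\col_j q`_j).
  apply: contra_neq v0 => /matrixP q0; apply/rowP => j.
  by rewrite vE; have := q0 j 0; rewrite !mxE => ->; rewrite mulr0.
suff /matrixP inj : toQ _ _ (A *m \col_j q`_j) = 0.
  apply/matrixP => i j; have := inj i j; rewrite [LHS]mxE [RHS]mxE => /eqP.
  by rewrite intr_eq0 => /eqP ->; rewrite mxE.
rewrite /toQ map_mxM; apply: trmx_inj; rewrite trmx_mul trmx0.
have -> : (map_mx intr (\col_j q`_j))^T = a%:~R *: v.
  by apply/rowP => j; rewrite !mxE vE mulrA divff // mul1r.
by rewrite -scalemxAl vA scaler0.
Qed.

Lemma ler_norm_det (R : realDomainType) n (A : 'M[R]_n) (c : 'I_n -> R) :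
  (forall i j, `|A i j| <= c j) -> `|\det A| <= n`!%:R * \prod_j c j.
Proof.
move=> h; apply: le_trans (ler_norm_sum _ _ _) _.
have -> : n`!%:R * \prod_j c j = \sum_(s : 'S_n) \prod_j c j.
  by rewrite sumr_const card_Sn mulr_natl.
apply: ler_sum => s _; rewrite normrM normrX normrN1 expr1n mul1r normr_prod.
rewrite [leRHS](reindex_inj (@perm_inj _ s)) /=.
by apply: ler_prod => i _; rewrite normr_ge0 h.
Qed.

Lemma eqz_mod_det n (A B : 'M[int]_n) (d : int) :
  (forall i j, (A i j = B i j %[mod d])%Z) -> (\det A = \det B %[mod d])%Z.
Proof.
move=> h; rewrite /determinant.
elim/big_ind2: _ => // [a b a' b' e e'|s _]; first by rewrite -modzDm e e' modzDm.
rewrite -modzMm -[in RHS]modzMm; congr ((_ * _) %% _)%Z.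
by elim/big_ind2: _ => // a b a' b' e e'; rewrite -modzMm e e' modzMm.
Qed.

(** Reducing each [psi j] modulo the monic product of the X - x_i keeps its values and brings its
    degree below n, so the matrix is a Vandermonde matrix times a matrix of coefficients. *)
Lemma det_horner_Vandermonde (R : comNzRingType) n (psi : 'I_n -> {poly R}) (x : 'rV[R]_n) :
  exists k, \det (\matrix_(i, j) (psi j).[x 0 i]) =
    k * \prod_(i < n) \prod_(j < n | (i < j)%N) (x 0 j - x 0 i).
Proof.
pose d := \prod_(i < n) ('X - (x 0 i)%:P).
have dm : d \is monic by apply: monic_prod_XsubC.
have sd : size d = n.+1 by rewrite size_prod_XsubC /index_enum -enumT size_enum_ord.
pose r j := Pdiv.Ring.rmodp (psi j) d.
have rE j i : (psi j).[x 0 i] = \sum_(k < n) x 0 i ^+ k * (r j)`_k.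
  rewrite [psi j](Pdiv.RingMonic.rdivp_eq dm) hornerD -/(r j).
  rewrite hornerM_comm; last exact: mulrC.
  have -> : d.[x 0 i] = 0 by rewrite horner_prod (bigD1 i) //= hornerXsubC subrr mul0r.
  rewrite mulr0 add0r (@horner_coef_wide _ n); last first.
    by rewrite -ltnS -sd Pdiv.Ring.ltn_rmodpN0 // monic_neq0.
  by apply: eq_bigr => k _; rewrite mulrC.
exists (\det (\matrix_(k < n, j < n) (r j)`_k)).
rewrite -det_Vandermonde mulrC -[\det (Vandermonde _ _)]det_tr -det_mulmx.
congr (\det _); apply/matrixP => i j; rewrite !mxE rE.
by apply: eq_bigr => k _; rewrite !mxE.
Qed.

Lemma dvdz_Vandermonde n (x : 'rV[int]_n) (p : int) :
  (forall i j, (p %| x 0%R j - x 0%R i)%Z) ->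
  (p ^+ 'C(n, 2) %| \prod_(i < n) \prod_(j < n | (i < j)%N) (x 0%R j - x 0%R i))%Z.
Proof.
move=> h.
have -> : 'C(n, 2) = (\sum_(i < n) \sum_(j < n | (i < j)%N) 1)%N.
  rewrite (exchange_big_dep xpredT) //=; under eq_bigr => j _.
    rewrite -(big_ord_widen n (fun=> 1%N)) ?(ltnW (ltn_ord j)) // sum1_card card_ord.
  over.
  by rewrite -bin2_sum big_mkord.
rewrite expr_sum; elim/big_ind2: _ => // [a b a' b'|i _]; first exact: dvdz_mul.
by rewrite expr_sum; elim/big_ind2: _ => // a b a' b'; apply: dvdz_mul.
Qed.

(** * Hensel lifting along the curve *)

Lemma horner_taylor2 (R : comNzRingType) (q : {poly R}) (v t : R) :
  exists k, q.[v] = q.[t] + q^`().[t] * (v - t) + k * (v - t) ^+ 2.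
Proof.
elim/poly_ind: q => [|q c [k kE]].
  by exists 0; rewrite deriv0 !horner0 !mul0r !addr0.
exists (q^`().[t] + k * v); rewrite !hornerMXaddC derivMXaddC hornerD hornerMX kE.
ring.
Qed.

Lemma dvdz_horner_sub (q : {poly int}) (a b d : int) :
  (d %| a - b)%Z -> (d %| q.[a] - q.[b])%Z.
Proof.
move=> h; have [k ->] := horner_taylor2 q a b.
have -> : q.[b] + q^`().[b] * (a - b) + k * (a - b) ^+ 2 - q.[b] =
  (q^`().[b] + k * (a - b)) * (a - b) by ring.
exact: dvdz_mull.
Qed.

Definition spec (x : int) (g : {poly {poly int}}) : {poly int} := map_poly (horner_eval x) g.

Lemma spec_horner x g q : (spec x g).[q.[x]] = g.[q].[x].
Proof. by rewrite /spec -[q.[x]]/(horner_eval x q) horner_map. Qed.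

Lemma spec_deriv x g : (spec x g)^`() = spec x g^`().
Proof. by rewrite /spec deriv_map. Qed.

Lemma dvdz_spec_sub g (x y u v d : int) :
  (d %| x - y)%Z -> (d %| u - v)%Z -> (d %| (spec x g).[u] - (spec y g).[v])%Z.
Proof.
move=> xy uv; have -> : (spec x g).[u] - (spec y g).[v] =
    ((spec x g).[u] - (spec x g).[v]) + ((spec x g).[v] - (spec y g).[v]) by ring.
apply: rpredD; first exact: dvdz_horner_sub.
have e z : (spec z g).[v] = g.[v%:P].[z] by rewrite -spec_horner hornerC.
by rewrite !e; apply: dvdz_horner_sub.
Qed.

Lemma coprimez_prime (p : nat) (w : int) : prime p -> ~~ (p %| w)%Z -> coprimez p w.
Proof. by move=> pp; rewrite dvdzE coprimezE /= prime_coprime. Qed.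

Lemma modz_inv (m w : int) : coprimez m w -> exists e, (m %| 1 - e * w)%Z.
Proof.
have [u [v uv]] := Bezoutz m w => /eqP g1.
by exists v; rewrite -g1 -uv addrK dvdz_mull.
Qed.

(* Newton iteration, run on polynomials in x instead of numbers. *)
Lemma hensel_polynomial (p : nat) (g : {poly {poly int}}) (x0 u0 : int) :
  prime p -> ~~ (p %| (spec x0 g^`()).[u0])%Z ->
  forall M, exists phi : {poly int}, forall x t : int,
    (p %| x - x0)%Z -> (p %| t - u0)%Z -> (p%:Z ^+ M %| (spec x g).[t])%Z ->
    (p%:Z ^+ M %| t - phi.[x])%Z.
Proof.
move=> p_pr nd; have [e eE] := modz_inv (coprimez_prime p_pr nd).
case; first by exists 0 => x t _ _ _; rewrite expr0 dvd1z.
elim=> [|M [phi IH]]; first by exists u0%:P => x t _ tu _; rewrite hornerC expr1.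
(* [e] is a fixed inverse modulo [p] of the derivative at the base point, so each iteration gains
   one power of [p]. *)
exists (phi - e *: g.[phi]) => x t xx tu gt.
have gt' : (p%:Z ^+ M.+1 %| (spec x g).[t])%Z.
  by apply: dvdz_trans gt; rewrite exprS dvdz_mull.
have := IH x t xx tu gt'.
rewrite hornerD hornerN hornerZ -spec_horner; set v := phi.[x] => dv.
have [k ->] := horner_taylor2 (spec x g) v t; rewrite spec_deriv.
set G := (spec x g^`()).[t].
have pG : (p %| 1 - e * G)%Z.
  have -> : 1 - e * G = (1 - e * (spec x0 g^`()).[u0]) - e * (G - (spec x0 g^`()).[u0]) by ring.
  by apply: rpredB => //; apply: dvdz_mull; apply: dvdz_spec_sub.
have -> : t - (v - e * ((spec x g).[t] + G * (v - t) + k * (v - t) ^+ 2)) =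
  (t - v) * (1 - e * G) + (e * (spec x g).[t] + e * k * ((t - v) * (t - v))) by ring.
apply: rpredD; first by rewrite exprSr dvdz_mul.
apply: rpredD; first exact: dvdz_mull.
apply: dvdz_mull; rewrite exprSr; apply: dvdz_mul => //.
by apply: dvdz_trans dv; rewrite exprS dvdz_mulr.
Qed.

(** For deg q <= n this is b^n q(a/b), computed without leaving the integers. *)
Definition hom_eval n (q : {poly int}) (a b : int) : int :=
  \sum_(j < n.+1) q`_j * a ^+ j * b ^+ (n - j).

Lemma hom_eval_horner n (q : {poly int}) (a b t d : int) : (size q <= n.+1)%N ->
  (d %| b * t - a)%Z -> (d %| b ^+ n * q.[t] - hom_eval n q a b)%Z.
Proof.
move=> qn dt; rewrite (horner_coef_wide _ qn) mulr_sumr -sumrB.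
apply: rpred_sum => j _.
have jn : (j <= n)%N by rewrite -ltnS.
have -> : b ^+ n * (q`_j * t ^+ j) - q`_j * a ^+ j * b ^+ (n - j) =
  q`_j * b ^+ (n - j) * ((b * t) ^+ j - a ^+ j).
  have -> : b ^+ n = b ^+ (n - j) * b ^+ j by rewrite -exprD subnK.
  by rewrite exprMn; ring.
apply: dvdz_mull; have := @dvdz_horner_sub 'X^j _ _ _ dt.
by rewrite !hornerXn.
Qed.

Lemma hom_eval_rat n (q : {poly int}) (t : rat) : (size q <= n.+1)%N ->
  (hom_eval n q (numq t) (denq t))%:~R = (map_poly intr q).[t] * (denq t)%:~R ^+ n :> rat.
Proof.
move=> qn; have qn' : (size (map_poly intr q : {poly rat}) <= n.+1)%N.
  by apply: leq_trans (size_poly _ _) qn.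
rewrite (horner_coef_wide _ qn') mulr_suml rmorph_sum /=; apply: eq_bigr => j _.
have jn : (j <= n)%N by rewrite -ltnS.
rewrite coef_map /= !rmorphM /= !rmorphXn /=.
have bQ : (denq t)%:~R != 0 :> rat by rewrite intr_eq0 denq_neq0.
have -> : t ^+ j = (numq t)%:~R ^+ j / (denq t)%:~R ^+ j.
  by rewrite -{1}[t]divq_num_den expr_div_n.
have -> : (denq t)%:~R ^+ n = (denq t)%:~R ^+ (n - j) * (denq t)%:~R ^+ j :> rat.
  by rewrite -exprD subnK.
by field; rewrite expf_neq0.
Qed.

(** As [p] does not divide b, the fraction a/b is represented modulo p^M by the integer t = e a with
    e inverse to b, and [hensel_polynomial] applies to t. *)
Lemma hensel_point (p : nat) (g : {poly {poly int}}) n (x0 u0 : int) :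
  prime p -> ~~ (p %| (spec x0 g^`()).[u0])%Z -> (size g <= n.+1)%N ->
  forall M, exists phi : {poly int}, forall x a b : int,
    ~~ (p %| b)%Z -> (p %| x - x0)%Z -> (p %| a - b * u0)%Z ->
    hom_eval n (spec x g) a b = 0 ->
    (p%:Z ^+ M %| a - b * phi.[x])%Z.
Proof.
move=> p_pr nd gn M; have [phi phiP] := hensel_polynomial p_pr nd M.
exists phi => x a b pb xx au h0.
case: M phiP => [|M] phiP; first by rewrite expr0 dvd1z.
have co : coprimez (p%:Z ^+ M.+1) b by rewrite coprimezXl ?coprimez_prime.
have [e eE] := modz_inv co; pose t := e * a.
have dt : (p%:Z ^+ M.+1 %| b * t - a)%Z.
  have -> : b * t - a = - ((1 - e * b) * a) by rewrite /t; ring.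
  by rewrite rpredN dvdz_mulr.
have pM : (p %| p%:Z ^+ M.+1)%Z by rewrite exprS dvdz_mulr.
have tu : (p %| t - u0)%Z.
  rewrite -(Gauss_dvdzr _ (coprimez_prime p_pr pb)).
  have -> : b * (t - u0) = (b * t - a) + (a - b * u0) by ring.
  by apply: rpredD => //; apply: dvdz_trans dt.
have sn : (size (spec x g) <= n.+1)%N by apply: leq_trans (size_poly _ _) gn.
have gt : (p%:Z ^+ M.+1 %| (spec x g).[t])%Z.
  have := hom_eval_horner sn dt; rewrite h0 subr0 Gauss_dvdzr //.
  by rewrite coprimezXr.
have -> : a - b * phi.[x] = b * (t - phi.[x]) - (b * t - a) by ring.
by apply: rpredB => //; apply: dvdz_mull; apply: phiP.
Qed.

(** * The determinant attached to a residue class *)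

Lemma big_ord_mul (R : Type) (idx : R) (op : Monoid.law idx) n k (F : nat -> R) :
  \big[op/idx]_(l < n * k) F l = \big[op/idx]_(j < n) \big[op/idx]_(i < k) F (j * k + i)%N.
Proof.
rewrite -(big_mkord xpredT F) big_nat_mul big_mkord; apply: eq_bigr => j _.
rewrite -{1}[(j * k)%N]add0n big_addn big_mkord mulSn addnK.
by apply: eq_bigr => i _; rewrite addnC.
Qed.

(* Columns are indexed by l = j * D1 + i, standing for the monomial x^i a^j b^(D2-1-j). *)
Definition monomial D1 D2 (x a b : int) (l : nat) : int :=
  x ^+ (l %% D1) * a ^+ (l %/ D1) * b ^+ (D2.-1 - l %/ D1).

(** The coefficients follow the column order of [monomial]; [rVpoly] makes the column accessible by
    natural number indices. *)
Definition bipoly D1 D2 (c : 'cV[int]_(D2 * D1)) : {poly {poly int}} :=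
  \poly_(j < D2) \poly_(i < D1) (rVpoly c^T)`_(j * D1 + i).

Lemma coef_bipoly D1 D2 (c : 'cV[int]_(D2 * D1)) j i : (j < D2)%N -> (i < D1)%N ->
  (bipoly c)`_j`_i = (rVpoly c^T)`_(j * D1 + i).
Proof. by move=> jD iD; rewrite coef_poly jD coef_poly iD. Qed.

Lemma size_bipoly D1 D2 (c : 'cV[int]_(D2 * D1)) : (size (bipoly c) <= D2)%N.
Proof. exact: size_poly. Qed.

Lemma sizeY_bipoly D1 D2 (c : 'cV[int]_(D2 * D1)) : (sizeY (bipoly c) <= D1)%N.
Proof.
apply/bigmax_leqP => j _; rewrite coef_poly; case: ifP => _; first exact: size_poly.
by rewrite size_poly0.
Qed.

Lemma bipoly_neq0 D1 D2 (c : 'cV[int]_(D2 * D1)) : (0 < D1)%N -> c != 0 -> bipoly c != 0.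
Proof.
move=> D10; apply: contra_neq => c0; apply/colP => l; rewrite mxE.
have := coef_rVpoly_ord c^T l; rewrite mxE => <-.
rewrite (divn_eq l D1) -coef_bipoly ?ltn_pmod ?ltn_divLR ?ltn_ord //.
by rewrite c0 !coef0.
Qed.

Lemma size_spec x g : (size (spec x g) <= size g)%N.
Proof. exact: size_poly. Qed.

(** This turns kernel vectors of the matrix of monomials into curves through the points. *)
Lemma sum_monomial D1 D2 (c : 'cV[int]_(D2 * D1)) x a b : (0 < D1)%N -> (0 < D2)%N ->
  \sum_(l < D2 * D1) monomial D1 D2 x a b l * c l 0 = hom_eval D2.-1 (spec x (bipoly c)) a b.
Proof.
move=> D10 D20; rewrite /hom_eval prednK //.
pose F l := monomial D1 D2 x a b l * (rVpoly c^T)`_l.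
transitivity (\sum_(l < D2 * D1) F l).
  by apply: eq_bigr => l _; rewrite /F coef_rVpoly_ord mxE.
rewrite (@big_ord_mul _ _ +%R); apply: eq_bigr => j _.
have -> : (spec x (bipoly c))`_j = \sum_(i < D1) (rVpoly c^T)`_(j * D1 + i) * x ^+ i.
  by rewrite coef_map /= /horner_eval coef_poly ltn_ord horner_poly.
rewrite !mulr_suml; apply: eq_bigr => i _.
rewrite /F /monomial divnMDl // modnMDl modn_small // divn_small // addn0.
ring.
Qed.

Lemma prod_monomial_bound D1 D2 (B1 B2 : int) : (0 < D1)%N ->
  \prod_(l < D2 * D1) (B1 ^+ (l %% D1) * B2 ^+ D2.-1) =
  B1 ^+ (D2 * 'C(D1, 2)) * B2 ^+ (D2 * D1 * D2.-1).
Proof.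
move=> D10; rewrite big_split /= prodr_const card_ord -exprM -expr_sum [(D2.-1 * _)%N]mulnC.
congr (_ ^+ _ * _); rewrite (@big_ord_mul _ _ addn D2 D1 (fun l => l %% D1)%N).
rewrite (eq_bigr (fun=> 'C(D1, 2))); first by rewrite sum_nat_const card_ord.
move=> j _; rewrite -bin2_sum big_mkord; apply: eq_bigr => i _.
by rewrite modnMDl modn_small.
Qed.

Lemma norm_monomial_le D1 D2 (B1 B2 x a b : int) l : (l < D2 * D1)%N ->
  0 <= B2 -> `|x| <= B1 -> `|a| <= B2 -> `|b| <= B2 ->
  `|monomial D1 D2 x a b l| <= B1 ^+ (l %% D1) * B2 ^+ D2.-1.
Proof.
move=> lD B20 xB aB bB; rewrite /monomial !normrM !normrX -mulrA.
have D10 : (0 < D1)%N by case: D1 lD; rewrite ?muln0.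
have pw (u v : int) k : `|u| <= v -> `|u| ^+ k <= v ^+ k.
  by move=> uv; apply: lerXn2r; rewrite // nnegrE // (le_trans _ uv).
have jD : (l %/ D1 <= D2.-1)%N by rewrite -ltnS prednK ?ltn_divLR //; case: D2 lD.
have -> : B2 ^+ D2.-1 = B2 ^+ (l %/ D1) * B2 ^+ (D2.-1 - l %/ D1).
  by rewrite -exprD subnKC.
apply: ler_pM; rewrite ?mulr_ge0 ?exprn_ge0 ?pw //.
by apply: ler_pM; rewrite ?exprn_ge0 ?pw.
Qed.

Lemma biev_hom_eval n (P : {poly {poly int}}) x t : (size P <= n.+1)%N ->
  biev P x t = 0 <-> hom_eval n (spec x P) (numq t) (denq t) = 0.
Proof.
move=> Pn; have sn : (size (spec x P) <= n.+1)%N by apply: leq_trans (size_spec _ _) Pn.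
have e := hom_eval_rat t sn.
have be : biev P x t = (map_poly intr (spec x P)).[t] by rewrite /biev map_poly_comp.
split=> [h|h].
  by apply/eqP; rewrite -(intr_eq0 rat) e -be h mul0r.
apply/eqP; rewrite be; have /eqP := e; rewrite h eq_sym mulf_eq0 => /orP[//|].
by rewrite expf_eq0 intr_eq0 (negbTE (denq_neq0 t)) andbF.
Qed.

Lemma sizeYM (P Q : {poly {poly int}}) : P != 0 -> Q != 0 ->
  sizeY (P * Q) = (sizeY P + sizeY Q).-1.
Proof. by move=> P0 Q0; rewrite !sizeYE rmorphM /= size_mul ?swapXY_eq0. Qed.

Lemma not_divides_size (g P : {poly {poly int}}) : P != 0 ->
  (size P < size g)%N || (sizeY P < sizeY g)%N -> ~ divides g P.
Proof.
move=> P0 lt [q PE]; have q0 : q != 0 by apply: contra_neq P0 => z; rewrite PE z mul0r.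
have g0 : g != 0 by apply: contra_neq P0 => z; rewrite PE z mulr0.
have sq : (0 < size q)%N by rewrite size_poly_gt0.
have sYq : (0 < sizeY q)%N by rewrite lt0n sizeY_eq0.
case/orP: lt; rewrite PE ?size_mul ?sizeYM // ltnNge => /negP[].
  by rewrite -(prednK sq) addSn leq_addl.
by rewrite -(prednK sYq) addSn leq_addl.
Qed.

Lemma rat_eq_cross (t u : rat) : numq t * denq u = numq u * denq t -> t = u.
Proof.
move=> h; rewrite -[t]divq_num_den -[u]divq_num_den.
apply/eqP; rewrite eqr_div ?intr_eq0 ?denq_neq0 // -!rmorphM /=.
by rewrite h.
Qed.

Section ResidueClass.

Variables (g : {poly {poly int}}) (p : nat) (x0 u0 : int).
Hypotheses (p_pr : prime p) (nd : ~~ (p %| (spec x0 g^`()).[u0])%Z).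

(** The last condition says that t is congruent to [u0] modulo [p], with the denominator multiplied
    out. *)
Definition in_class (z : int * rat) : Prop :=
  [/\ biev g z.1 z.2 = 0, ~~ (p %| denq z.2)%Z, (p %| z.1 - x0)%Z
    & (p %| numq z.2 - denq z.2 * u0)%Z].

Lemma in_class_hensel M : exists phi : {poly int}, forall z, in_class z ->
  (p%:Z ^+ M %| numq z.2 - denq z.2 * phi.[z.1])%Z.
Proof.
have [phi phiP] := hensel_point p_pr nd (leqSpred (size g)) M.
exists phi => z [zg pb px pt]; apply: phiP => //.
by apply/(biev_hom_eval _ _ (leqSpred _)).
Qed.

(** Both t and u agree with phi(x) modulo any power of [p]. The cross difference e is thus divisible
    by p^|e|, which is larger than |e|, so e = 0. *)
Lemma in_class_inj z w : in_class z -> in_class w -> z.1 = w.1 -> z = w.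
Proof.
case: z w => [x t] [y u] zc wc /= xy; subst y; congr (_, _).
apply: rat_eq_cross; apply/eqP; rewrite -subr_eq0; apply/eqP.
set e := _ - _; pose M := `|e|%N.
have [phi phiP] := in_class_hensel M.
have : (p%:Z ^+ M %| e)%Z.
  have -> : e = (numq t - denq t * phi.[x]) * denq u - (numq u - denq u * phi.[x]) * denq t.
    by rewrite /e; ring.
  apply: rpredB; apply: dvdz_mulr; first exact: (phiP _ zc).
  exact: (phiP _ wc).
rewrite dvdzE abszX /=; have [/eqP|M0] := posnP M; first by rewrite absz_eq0 => /eqP.
move=> /(dvdn_leq M0); rewrite leqNgt => /negP[].
by apply: ltn_expl; apply: prime_gt1.
Qed.

(** Modulo p^M one has a = b phi(x), so the row of a point is b^(D2-1) times the values at x of the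
    polynomials X^i phi^j. [det_horner_Vandermonde] then yields one factor [p] for each pair of
    points. *)
Lemma residue_class_det D1 D2 (z : 'I_(D2 * D1) -> int * rat) :
  (0 < D1)%N -> (forall i, in_class (z i)) ->
  (p%:Z ^+ 'C(D2 * D1, 2) %|
   \det (\matrix_(i, l) monomial D1 D2 (z i).1 (numq (z i).2) (denq (z i).2) l : 'M[int]_(D2 * D1)%N))%Z.
Proof.
move=> D10 zc; set M := 'C(_, _).
have [phi phiP] := in_class_hensel M.
pose x : 'rV[int]_(D2 * D1) := \row_i (z i).1.
pose psi (l : 'I_(D2 * D1)) : {poly int} := 'X^(l %% D1) * phi ^+ (l %/ D1).
pose bd : 'rV[int]_(D2 * D1) := \row_i denq (z i).2 ^+ D2.-1.
have [k kE] := det_horner_Vandermonde psi x.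
pose N : 'M[int]_(D2 * D1) := diag_mx bd *m \matrix_(i, j) (psi j).[x 0 i].
have dN : (p%:Z ^+ M %| \det N)%Z.
  rewrite det_mulmx; apply: dvdz_mull; rewrite kE; apply: dvdz_mull.
  apply: dvdz_Vandermonde => i j; rewrite !mxE.
  have [_ _ pi _] := zc i; have [_ _ pj _] := zc j.
  have -> : (z j).1 - (z i).1 = ((z j).1 - x0) - ((z i).1 - x0) by ring.
  exact: rpredB.
apply/dvdz_mod0P; rewrite (eqz_mod_det (B := N)); first exact/dvdz_mod0P.
move=> i l; rewrite /N mul_diag_mx !mxE /monomial.
set a := numq _; set b := denq _; set v := (z i).1.
have jD : (l %/ D1 <= D2.-1)%N.
  by rewrite -ltnS prednK ?ltn_divLR //; case: (D2) l => [[]|].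
have -> : b ^+ D2.-1 = b ^+ (l %/ D1) * b ^+ (D2.-1 - l %/ D1) by rewrite -exprD subnKC.
apply/eqP; rewrite eqz_mod_dvd hornerM hornerXn horner_exp.
have -> : v ^+ (l %% D1) * a ^+ (l %/ D1) * b ^+ (D2.-1 - l %/ D1) -
  b ^+ (l %/ D1) * b ^+ (D2.-1 - l %/ D1) * (v ^+ (l %% D1) * phi.[v] ^+ (l %/ D1)) =
  v ^+ (l %% D1) * b ^+ (D2.-1 - l %/ D1) * (a ^+ (l %/ D1) - (b * phi.[v]) ^+ (l %/ D1)).
  by rewrite exprMn; ring.
apply: dvdz_mull; have := @dvdz_horner_sub 'X^(l %/ D1) _ _ _ (phiP _ (zc i)).
by rewrite !hornerXn.
Qed.

End ResidueClass.

(** * Counting the points of one residue class *)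

Definition bounded_by (B1 B2 : nat) (z : int * rat) : bool :=
  (`|z.1| <= B1%:Z) && (height z.2 <= B2%:Z).

Lemma bounded_byP B1 B2 z : bounded_by B1 B2 z ->
  [/\ `|z.1| <= B1%:Z, `|numq z.2| <= B2%:Z & `|denq z.2| <= B2%:Z].
Proof. by case/andP=> xB; rewrite ge_max => /andP[]. Qed.

Lemma uniq_root_size (r : {poly int}) (s : seq (int * rat)) : r != 0 -> uniq s ->
  {in s &, injective fst} -> (forall z, z \in s -> root r z.1) -> (size s < size r)%N.
Proof.
move=> r0 us inj rs; rewrite -(size_map fst); apply: max_poly_roots => //.
  by apply/allP => _ /mapP[z zs ->]; apply: rs.
by rewrite map_inj_in_uniq.
Qed.

(** Here [p] is any natural number; [residue_class_size] takes for it the power of the prime that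
    divides the determinant. *)
Lemma small_det_eq0 (p D1 D2 B1 B2 : nat) (z : 'I_(D2 * D1) -> int * rat) :
  (0 < D1)%N -> (forall i, bounded_by B1 B2 (z i)) ->
  ((D2 * D1)`! * (B1 ^ (D2 * 'C(D1, 2)) * B2 ^ (D2 * D1 * D2.-1)) < p)%N ->
  let d := \det (\matrix_(i, l) monomial D1 D2 (z i).1 (numq (z i).2) (denq (z i).2) l
    : 'M[int]_(D2 * D1)%N) in
  (p%:Z %| d)%Z -> d = 0.
Proof.
move=> D10 zB lt d.
have dle : (`|d| <=
    (D2 * D1)`! * (B1 ^ (D2 * 'C(D1, 2)) * B2 ^ (D2 * D1 * D2.-1)))%N.
  rewrite -lez_nat PoszM abszE.
  have -> : (B1 ^ (D2 * 'C(D1, 2)) * B2 ^ (D2 * D1 * D2.-1))%N%:Z =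
      \prod_(l < D2 * D1) (B1%:Z ^+ (l %% D1) * B2%:Z ^+ D2.-1).
    by rewrite prod_monomial_bound // PoszM -!natz !natrX.
  have -> : ((D2 * D1)`!)%:Z = ((D2 * D1)`!)%:R by rewrite natz.
  apply: ler_norm_det => i l; rewrite mxE.
  by have [xB aB bB] := bounded_byP (zB i); apply: norm_monomial_le.
rewrite dvdzE /= => /dvdn_leq h; apply/eqP; rewrite -absz_eq0 -leqn0 leqNgt.
apply/negP => /h; rewrite leqNgt => /negP[]; exact: leq_ltn_trans dle lt.
Qed.

Section ResidueClassBound.

Variables (g : {poly {poly int}}) (p : nat) (x0 u0 : int).
Hypotheses (p_pr : prime p) (nd : ~~ (p %| (spec x0 g^`()).[u0])%Z).
Hypotheses (gI : ring_irreducible g) (g1 : (1 < size g)%N).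

(** A nonzero maximal minor would be too small for its divisibility by a power of [p]. Hence a
    nonzero curve with sizes at most [D1] and [D2] contains the points; it is no multiple of [g]
    because one of its degrees is smaller. *)
Lemma residue_class_size D1 D2 B1 B2 (pts : seq (int * rat)) :
  (0 < D1)%N -> (0 < D2)%N -> (D1 < sizeY g)%N || (D2 < size g)%N -> uniq pts ->
  (forall z, z \in pts -> in_class g p x0 u0 z) ->
  (forall z, z \in pts -> bounded_by B1 B2 z) ->
  ((D2 * D1)`! * (B1 ^ (D2 * 'C(D1, 2)) * B2 ^ (D2 * D1 * D2.-1)) < p ^ 'C(D2 * D1, 2))%N ->
  (size pts <= (sizeY g).-1 * D2 + D1 * (size g).-1)%N.
Proof.
move=> D10 D20 Dlt us cl bd lt.
pose z (i : 'I_(size pts)) := tnth (in_tuple pts) i.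
have zin i : z i \in pts by apply: mem_tnth.
pose A : 'M[int]_(size pts, D2 * D1) :=
  \matrix_(i, l) monomial D1 D2 (z i).1 (numq (z i).2) (denq (z i).2) l.
have [[c c0 Ac]|[r]] := int_kernel_or_minor A; last first.
  move=> /eqP[]; have -> : rowsub r A = \matrix_(i, l)
    monomial D1 D2 (z (r i)).1 (numq (z (r i)).2) (denq (z (r i)).2) l.
    by apply/matrixP => i l; rewrite !mxE.
  apply: (small_det_eq0 D10 _ lt) => [i|]; first exact/bd.
  rewrite -natz natrX natz.
  by apply: (residue_class_det p_pr nd) => // i; apply: cl.
pose P := bipoly c; have P0 : P != 0 by apply: bipoly_neq0.
have gP : ~ divides g P.
  apply: not_divides_size => //; rewrite orbC.
  by case/orP: Dlt => h; apply/orP; [left|right]; apply: leq_ltn_trans h;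
    [apply: sizeY_bipoly|apply: size_bipoly].
have [||q [q0 sq qr]] := common_zeros (e1 := D1.-1) (e2 := D2.-1) gI g1 gP.
- by rewrite prednK //; apply: sizeY_bipoly.
- by rewrite prednK //; apply: size_bipoly.
(* Inside the class x determines t, so counting x-coordinates is enough. *)
have : (size pts < size q)%N.
  apply: uniq_root_size => // [v w vs ws|v vs].
    by apply: (in_class_inj p_pr nd); apply: cl.
  have [vg _ _ _] := cl _ vs; apply: (qr _ v.2) => //.
  apply/(@biev_hom_eval D2.-1); first by rewrite prednK //; apply: size_bipoly.
  rewrite -sum_monomial //.
  pose i : 'I_(size pts) := Ordinal (etrans (index_mem v pts) vs).
  have zi : z i = v by rewrite /z (tnth_nth v) /= nth_index.
  have /matrixP /(_ i 0) := Ac; rewrite [LHS]mxE [RHS]mxE => e; rewrite -[RHS]e.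
  by apply: eq_bigr => l _; rewrite mxE zi.
move=> /leq_trans /(_ sq); rewrite ltnS => /leq_trans; apply.
by apply: leq_add; rewrite leq_mul ?leq_pred.
Qed.

End ResidueClassBound.

(** * Coefficient size *)

Lemma size_le_fibers (T : Type) (K : eqType) (f : T -> K) (ks : seq K) L (s : seq T) :
  all (fun z => f z \in ks) s ->
  (forall k, k \in ks -> (size [seq z <- s | f z == k] <= L)%N) ->
  (size s <= size ks * L)%N.
Proof.
elim: ks s => [|k ks IH] s sk h.
  by case: s sk {h} => //= z s; rewrite in_nil.
rewrite mulSn -(count_predC (fun z => f z == k) s) leq_add //.
  by rewrite -size_filter h ?mem_head.
rewrite -size_filter; apply: IH => [|k' k'ks].
  rewrite all_filter; apply: sub_all sk => z /=; rewrite inE => /orP[->//|->].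
  exact: implybT.
apply: leq_trans (h k' _); last by rewrite inE k'ks orbT.
by rewrite -filter_predI !size_filter; apply: sub_count => z /= /andP[].
Qed.

(** Otherwise X - x would divide [g], by the factor theorem after swapping the variables, against
    irreducibility and positive U-degree. *)
Lemma spec_neq0 (g : {poly {poly int}}) x :
  ring_irreducible g -> (1 < size g)%N -> spec x g != 0.
Proof.
move=> [g0 gU gI] g1; apply/eqP => s0.
have /factor_theorem [q qE] : root (swapXY g) x%:P.
  by rewrite rootE horner_swapXY -/(spec x g) s0.
have gE : g = swapXY q * ('X - x%:P)%:P.
  rewrite -[g]swapXYK qE rmorphM rmorphB /= swapXY_X swapXY_polyC map_polyC.
  by rewrite polyCB.
case: (gI _ _ gE) => [/unit_size1 s1|].
  have := size_polyMleq (swapXY q) ('X - x%:P)%:P; rewrite -gE s1.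
  by rewrite size_polyC polyXsubC_eq0 leqNgt g1.
by rewrite poly_unitE coefC poly_unitE size_XsubC andbF.
Qed.

Lemma zeros_per_x (g : {poly {poly int}}) x (s : seq rat) :
  ring_irreducible g -> (1 < size g)%N -> uniq s ->
  (forall t, t \in s -> biev g x t = 0) -> (size s <= (size g).-1)%N.
Proof.
move=> gI g1 us sz; have sp := spec_neq0 x gI g1.
pose q : {poly rat} := map_poly intr (spec x g).
have q0 : q != 0 by rewrite map_poly_eq0_id0 // intr_eq0 lead_coef_eq0.
rewrite -ltnS (ltn_predK g1); apply: leq_trans (_ : size s < size q)%N _.
  apply: max_poly_roots => //; apply/allP => t /sz.
  by rewrite /biev map_poly_comp => /eqP.
by apply: leq_trans (size_poly _ _) (size_spec _ _).
Qed.

Lemma zeros_over_roots (g : {poly {poly int}}) (r : {poly int}) K (pts : seq (int * rat)) :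
  ring_irreducible g -> (1 < size g)%N -> uniq pts -> r != 0 -> (size r <= K.+1)%N ->
  (forall z, z \in pts -> biev g z.1 z.2 = 0) ->
  (forall z, z \in pts -> root r z.1) -> (size pts <= K * (size g).-1)%N.
Proof.
move=> gI g1 us r0 rK zg zr; pose xs := undup (map fst pts).
have xK : (size xs <= K)%N.
  rewrite -ltnS; apply: leq_trans rK; apply: max_poly_roots; rewrite ?undup_uniq //.
  by apply/allP => x; rewrite mem_undup => /mapP[z zp ->]; apply: zr.
apply: leq_trans (leq_mul xK (leqnn _)).
apply: (size_le_fibers (f := fst)) => [|x _].
  by apply/allP => z zp; rewrite mem_undup map_f.
rewrite -(size_map snd); apply: (zeros_per_x (x := x)) => //.
  rewrite map_inj_in_uniq ?filter_uniq // => -[x1 t1] [x2 t2].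
  by rewrite !mem_filter /= => /andP[/eqP -> _] /andP[/eqP -> _] ->.
by move=> t /mapP[[x' t']]; rewrite mem_filter /= => /andP[/eqP -> /zg] /= ? ->.
Qed.

(** Outside a residue class x no longer determines t; each root of the resultant carries at most
    deg_U g points, whence the last factor. *)
Lemma common_zeros_size (g P : {poly {poly int}}) e1 e2 (pts : seq (int * rat)) :
    ring_irreducible g -> (1 < size g)%N -> ~ divides g P ->
    (sizeY P <= e1.+1)%N -> (size P <= e2.+1)%N -> uniq pts ->
  (forall z, z \in pts -> biev g z.1 z.2 = 0) ->
  (forall z, z \in pts -> biev P z.1 z.2 = 0) ->
  (size pts <= ((sizeY g).-1 * e2 + e1 * (size g).-1) * (size g).-1)%N.
Proof.
move=> gI g1 gP Pe1 Pe2 us zg zP; have [r [r0 sr rr]] := common_zeros gI g1 gP Pe1 Pe2.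
by apply: (zeros_over_roots gI g1 us r0 sr zg) => z zp; apply: rr (zg _ zp) (zP _ zp).
Qed.

Lemma primitive_dvdn (f : {poly {poly int}}) (d D : nat) : primitive f ->
  (forall i j, d %| D * absz (f`_i`_j)%R)%N -> (d %| D)%N.
Proof.
move=> fprim h; rewrite -[D]muln1 -fprim.
rewrite (big_morph (muln D) (muln_gcdr D) (muln0 D)).
apply/dvdn_biggcdP => i _.
rewrite (big_morph (muln D) (muln_gcdr D) (muln0 D)).
by apply/dvdn_biggcdP => j _; apply: h.
Qed.

(** The degrees would force the quotient to be a nonzero integer, so [P] would have the same
    monomials as [g]. *)
Lemma divides_same_size (g P : {poly {poly int}}) j i : P != 0 ->
  (size P <= size g)%N -> (sizeY P <= sizeY g)%N -> g`_j`_i != 0 -> P`_j`_i = 0 ->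
  ~ divides g P.
Proof.
move=> P0 sP sYP gji Pji [q PE].
have q0 : q != 0 by apply: contra_neq P0 => z; rewrite PE z mul0r.
have g0 : g != 0 by apply: contra_neq P0 => z; rewrite PE z mulr0.
have sq : (0 < size q)%N by rewrite size_poly_gt0.
have sYq : (0 < sizeY q)%N by rewrite lt0n sizeY_eq0.
have sg : (0 < size g)%N by rewrite size_poly_gt0.
have sYg : (0 < sizeY g)%N by rewrite lt0n sizeY_eq0.
have q1 : (size q <= 1)%N.
  move: sP; rewrite PE size_mul // -(prednK sq) addSn /= => h.
  by rewrite ltnS -(leq_add2r (size g)) add0n.
have qY1 : (sizeY q <= 1)%N.
  move: sYP; rewrite PE sizeYM // -(prednK sYq) addSn /= => h.
  by rewrite ltnS -(leq_add2r (sizeY g)) add0n.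
have qE := size1_polyC q1.
have q0E := size1_polyC (leq_trans (max_size_coefXY q 0) qY1).
move: Pji; rewrite PE qE coefCM q0E coefCM => /eqP; rewrite mulf_eq0 (negbTE gji) orbF => /eqP q00.
by move: q0; rewrite qE q0E q00 !polyC0 eqxx.
Qed.

Lemma monomial_le_height D1 D2 (B1 B2 : nat) z l : (l < D2 * D1)%N ->
  (0 < B1)%N -> (0 < B2)%N -> bounded_by B1 B2 z ->
  `|monomial D1 D2 z.1 (numq z.2) (denq z.2) l| <= (B1 ^ D1.-1 * B2 ^ D2.-1)%:Z.
Proof.
move=> lD B10 B20 zB; have [xB aB bB] := bounded_byP zB.
have D10 : (0 < D1)%N by case: D1 lD; rewrite ?muln0.
apply: le_trans (norm_monomial_le lD _ xB aB bB) _ => //.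
rewrite -!natz -!natrX -natrM !natz lez_nat leq_mul // leq_pexp2l //.
by rewrite -ltnS prednK // ltn_pmod.
Qed.

(* Adjoin to the matrix of monomials a unit row selecting a coefficient of g:
   either the columns stay dependent, which yields a second curve through the
   points, or Cramer's rule makes that coefficient divide a minor, g being
   primitive. *)
Lemma coef_bound (f g : {poly {poly int}}) (B1 B2 : nat) (pts : seq (int * rat)) :
  primitive f -> g = swapXY f -> ring_irreducible g -> (1 < size g)%N ->
  (0 < B1)%N -> (0 < B2)%N -> uniq pts ->
  (forall z, z \in pts -> biev g z.1 z.2 = 0) ->
  (forall z, z \in pts -> bounded_by B1 B2 z) ->
  let n := (size g * sizeY g)%N in
  (size pts <= ((sizeY g).-1 * (size g).-1).*2 * (size g).-1)%N \/
  (forall j i, `|g`_j`_i| <= (n`! * (B1 ^ (sizeY g).-1 * B2 ^ (size g).-1) ^ n)%N%:Z).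
Proof.
move=> fprim gE gI g1 B10 B20 us zg zB n.
(* The threshold is the bound of [common_zeros_size] for a second curve of the bidegree of [g]. *)
have [small|large] := leqP (size pts) (((sizeY g).-1 * (size g).-1).*2 * (size g).-1)%N; first by left.
right=> j i; have [->|gji] := eqVneq g`_j`_i 0; first by rewrite normr0.
have g0 : g != 0 by case: gI.
have sg : (0 < size g)%N by rewrite size_poly_gt0.
have sYg : (0 < sizeY g)%N by rewrite lt0n sizeY_eq0.
have jg : (j < size g)%N by rewrite ltnNge; apply: contraNN gji => h; rewrite (nth_default _ h) coef0.
have ig : (i < sizeY g)%N.
  rewrite ltnNge; apply: contraNN gji => h; apply/eqP/nth_default.
  exact: leq_trans (max_size_coefXY g j) h.
have lP : (j * sizeY g + i < size g * sizeY g)%N by nia.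
pose l := Ordinal lP.
pose z (k : 'I_(size pts)) := tnth (in_tuple pts) k.
have zin k : z k \in pts by apply: mem_tnth.
pose A0 : 'M[int]_(size pts, n) :=
  \matrix_(k, l) monomial (sizeY g) (size g) (z k).1 (numq (z k).2) (denq (z k).2) l.
pose A : 'M[int]_(size pts + 1, n) := col_mx A0 (delta_mx 0 l).
have zrow (c : 'cV[int]_n) k :
    (A0 *m c) k 0 = hom_eval (size g).-1 (spec (z k).1 (bipoly c)) (numq (z k).2) (denq (z k).2).
  by rewrite mxE -sum_monomial //; apply: eq_bigr => l' _; rewrite mxE.
have [[c c0]|[r]] := int_kernel_or_minor A.
  rewrite mul_col_mx -col_mx0 => /eq_col_mx [A0c].
  (* The unit row forces [c] to vanish at [l], where [g] has a nonzero coefficient; so the second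
     curve is no multiple of [g]. *)
  rewrite -rowE => /matrixP /(_ 0 0); rewrite mxE [RHS]mxE => cl.
  pose P := bipoly c; have P0 : P != 0 by apply: bipoly_neq0.
  have gP : ~ divides g P.
    apply: (divides_same_size (j := j) (i := i)) => //.
    - exact: size_bipoly.
    - exact: sizeY_bipoly.
    - by rewrite coef_bipoly // -[(j * _ + i)%N]/(nat_of_ord l) coef_rVpoly_ord mxE.
  have := @common_zeros_size g P (sizeY g).-1 (size g).-1 pts gI g1 gP.
  rewrite !prednK // addnn => /(_ (sizeY_bipoly _) (size_bipoly _) us zg) h.
  move: large; rewrite ltnNge => /negP[]; apply: h => w wp.
  apply/(@biev_hom_eval (size g).-1); first by rewrite prednK //; apply: size_bipoly.
  pose k : 'I_(size pts) := Ordinal (etrans (index_mem w pts) wp).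
  have zk : z k = w by rewrite /z (tnth_nth w) /= nth_index.
  by rewrite -zk -zrow A0c mxE.
set M := rowsub r A => M0.
pose gv : 'cV[int]_n := \col_l' g`_(l' %/ sizeY g)`_(l' %% sizeY g).
have bg : bipoly gv = g.
  apply/polyP => j'; rewrite coef_poly; case: ifP => [j'g|/negbT]; last first.
    by rewrite -leqNgt => h; rewrite nth_default.
  apply/polyP => i'; rewrite coef_poly; case: ifP => [i'g|/negbT]; last first.
    rewrite -leqNgt => h; rewrite nth_default //.
    exact: leq_trans (max_size_coefXY g j') h.
  have lt : (j' * sizeY g + i' < n)%N by rewrite /n; nia.
  rewrite -[(j' * _ + i')%N]/(nat_of_ord (Ordinal lt)) coef_rVpoly_ord !mxE /=.
  by rewrite divnMDl // modnMDl modn_small // divn_small // addn0.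
pose W : 'cV[int]_(size pts + 1) := col_mx 0 (const_mx 1).
(* The rows of monomials annihilate [gv] because [g] vanishes at the points; the unit row reads off
   the selected coefficient. *)
have AW : A *m gv = g`_j`_i *: W.
  rewrite mul_col_mx scale_col_mx scaler0; congr col_mx.
    apply/matrixP => k k'; rewrite ord1 zrow bg mxE.
    exact/(biev_hom_eval _ _ (leqSpred _))/zg.
  apply/matrixP => k k'; rewrite !ord1 -rowE !mxE /= mulr1.
  by rewrite divnMDl // modnMDl modn_small // divn_small // addn0.
have detM : \det M *: gv = g`_j`_i *: (\adj M *m rowsub r W).
  rewrite -mul_scalar_mx -mul_adj_mx -mulmxA scalemxAr mul_rowsub_mx AW.
  by congr (_ *m _); apply/matrixP => k k'; rewrite !mxE.
(* The selected coefficient divides the product of [\det M] with every coefficient of [g], hence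
   [\det M] itself by primitivity. *)
have dvd : (`|g`_j`_i|%R %| \det M)%Z.
  rewrite dvdzE; apply: (primitive_dvdn fprim) => i' j'.
  rewrite absz_id; have -> : f`_i'`_j' = g`_j'`_i' by rewrite gE coef_swapXY.
  have [h|h] := leqP (size g) j'; first by rewrite (nth_default _ h) coef0 muln0.
  have [h'|h'] := leqP (sizeY g) i'.
    rewrite [_`_i']nth_default ?muln0 //.
    exact: leq_trans (max_size_coefXY g j') h'.
  have lt : (j' * sizeY g + i' < n)%N by rewrite /n; nia.
  have /matrixP /(_ (Ordinal lt) 0) := detM; rewrite !mxE /=.
  rewrite divnMDl // modnMDl modn_small // divn_small // addn0.
  by move=> /(congr1 absz); rewrite !abszM => ->; apply: dvdn_mulr.
apply: le_trans (_ : `|\det M| <= _).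
  by rewrite -!abszE lez_nat; move: dvd; rewrite dvdzE absz_id; apply: dvdn_leq; rewrite absz_gt0.
have -> : (n`! * (B1 ^ (sizeY g).-1 * B2 ^ (size g).-1) ^ n)%N%:Z =
  n`!%:R * \prod_(l' < n) (B1 ^ (sizeY g).-1 * B2 ^ (size g).-1)%N%:Z.
  by rewrite prodr_const card_ord PoszM -!natz natrX.
apply: ler_norm_det => k l'; rewrite mxE /A.
rewrite -[r k]splitK; case: fintype.split => k' /=.
  by rewrite col_mxEu mxE; apply: monomial_le_height => //; apply: zB.
rewrite col_mxEd mxE normr_nat natz.
rewrite lez_nat; apply: leq_trans (leq_b1 _) _.
by rewrite muln_gt0 !expn_gt0 B10 B20.
Qed.

(** * Counting points modulo a prime *)

Lemma size_deriv_leq (g : {poly {poly int}}) : (1 < size g)%N -> (size g^`() <= (size g).-2.+1)%N.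
Proof.
move=> g1; have g0 : g != 0 by rewrite -size_poly_gt0 ltnW.
by have := lt_size_deriv g0; case: (size g) g1 => [|[|m]].
Qed.

Section PrimeCount.

Variables (g : {poly {poly int}}) (p : nat).
Hypotheses (p_pr : prime p) (gI : ring_irreducible g) (g1 : (1 < size g)%N).

Let lift (c : 'F_p) : int := (nat_of_ord c)%:Z.

Definition simple_root (k : 'F_p * 'F_p) : bool :=
  (p %| (spec (lift k.1) g).[lift k.2])%Z && ~~ (p %| (spec (lift k.1) g^`()).[lift k.2])%Z.

Lemma intr_lift c : (lift c)%:~R = c :> 'F_p.
Proof. exact: natr_Zp. Qed.

Lemma dvdz_intr_Fp (m : int) : (p %| m)%Z = (m%:~R == 0 :> 'F_p).
Proof. by rewrite (dvdz_pcharf (pchar_Fp p_pr)). Qed.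

(** If there is a simple root over [c], then g(c, U) is nonzero modulo [p], as its derivative is,
    and has at most deg_U g roots; otherwise the list is empty. *)
Lemma simple_roots_over (c : 'F_p) :
  (size [seq k <- enum simple_root | k.1 == c] <= (size g).-1)%N.
Proof.
set s := (X in (size X <= _)%N); case sE : s => [//|k0 s'].
have k0s : k0 \in s by rewrite sE mem_head.
pose Q : {poly 'F_p} := map_poly intr (spec (lift c) g).
have ev (q : {poly int}) (u : 'F_p) : (map_poly intr q).[u] = (q.[lift u])%:~R.
  by rewrite -horner_map /= intr_lift.
have Q0 : Q != 0.
  move: k0s; rewrite mem_filter mem_enum => /andP[/eqP k0c /andP[_]].
  rewrite k0c; apply: contra => /eqP Q0; rewrite dvdz_intr_Fp -ev -spec_deriv.
  by rewrite -deriv_map -/Q Q0 deriv0 horner0.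
rewrite -sE -ltnS (ltn_predK g1); apply: leq_trans (_ : size s < size Q)%N _; last first.
  by apply: leq_trans (size_poly _ _) (size_spec _ _).
rewrite -(size_map snd); apply: max_poly_roots => //.
  apply/allP => u /mapP[k]; rewrite mem_filter mem_enum => /andP[/eqP kc /andP[h _]] ->.
  by rewrite rootE ev -dvdz_intr_Fp -kc.
rewrite map_inj_in_uniq; first by apply/filter_uniq/enum_uniq.
move=> -[a b] [a' b'].
by rewrite !mem_filter /= => /andP[/eqP -> _] /andP[/eqP -> _] ->.
Qed.

Lemma card_simple_root : (size (enum simple_root) <= p * (size g).-1)%N.
Proof.
have pE : p = size (enum 'F_p) by rewrite -cardE card_Fp.
rewrite [X in (_ <= X * _)%N]pE; apply: (size_le_fibers (f := fst)) => [|c _].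
  by apply/allP => k _; rewrite mem_enum.
exact: simple_roots_over.
Qed.

(* If p does not divide it, then t is p-integral and the curve is smooth in the
   U-direction at the reduction of (x, t). *)
Definition smooth_index (z : int * rat) : int :=
  denq z.2 * hom_eval (size g).-2 (spec z.1 g^`()) (numq z.2) (denq z.2).

(** Division by zero in ['F_p] gives 0, so the second coordinate is the reduction of t only when [p]
    does not divide the denominator. *)
Definition residue (z : int * rat) : 'F_p * 'F_p :=
  (z.1%:~R, (numq z.2)%:~R / (denq z.2)%:~R).

(** Since [p] does not divide the denominator, homogenising changes neither the vanishing of [g]
    modulo [p] nor that of its U-derivative. *)
Lemma smooth_residue z : biev g z.1 z.2 = 0 -> ~~ (p %| smooth_index z)%Z ->
  simple_root (residue z) /\
  in_class g p (lift (residue z).1) (lift (residue z).2) z.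
Proof.
move=> zg; set x0 := lift _; set u0 := lift _ => pN.
have pb : ~~ (p %| denq z.2)%Z by apply: contra pN => h; apply: dvdz_mulr.
have px : (p %| z.1 - x0)%Z.
  by rewrite dvdz_intr_Fp rmorphB /= intr_lift subrr.
have pt : (p %| numq z.2 - denq z.2 * u0)%Z.
  rewrite dvdz_intr_Fp rmorphB rmorphM /= intr_lift /= mulrC divfK ?subrr //.
  by rewrite -dvdz_intr_Fp.
have px' : (p %| x0 - z.1)%Z by rewrite -opprB rpredN.
have pt' : (p %| denq z.2 * u0 - numq z.2)%Z by rewrite -opprB rpredN.
split; last by split.
have cop := coprimez_prime p_pr pb.
apply/andP; split.
  have sg := leq_trans (size_spec z.1 g) (leqSpred (size g)).
  have := hom_eval_horner sg pt'.
  rewrite (iffLR (biev_hom_eval z.1 z.2 (leqSpred (size g))) zg) subr0.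
  rewrite Gauss_dvdzr ?coprimezXr // => h.
  have := dvdz_spec_sub g px' (_ : (p %| u0 - u0)%Z); rewrite subrr dvdz0 => /(_ isT).
  by move=> h'; rewrite -[X in (_ %| X)%Z](subrK (spec z.1 g).[u0]) rpredD.
have sg' := leq_trans (size_spec z.1 g^`()) (size_deriv_leq g1).
apply: contra pN => h; apply: dvdz_mull.
have := hom_eval_horner sg' pt'.
have h' : (p %| (spec z.1 g^`()).[u0])%Z.
  have := dvdz_spec_sub g^`() px (_ : (p %| u0 - u0)%Z); rewrite subrr dvdz0 => /(_ isT).
  by move=> h'; rewrite -[X in (_ %| X)%Z](subrK (spec x0 g^`()).[u0]) rpredD.
move=> h2; rewrite -[X in (_ %| X)%Z](subKr (denq z.2 ^+ (size g).-2 * (spec z.1 g^`()).[u0])).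
by rewrite rpredB // dvdz_mull.
Qed.

(** There are at most p deg_U g classes of simple roots, and [residue_class_size] bounds each of
    them. *)
Lemma prime_count D1 D2 B1 B2 (pts : seq (int * rat)) :
  (0 < D1)%N -> (0 < D2)%N -> (D1 < sizeY g)%N || (D2 < size g)%N -> uniq pts ->
  (forall z, z \in pts -> biev g z.1 z.2 = 0) ->
  (forall z, z \in pts -> bounded_by B1 B2 z) ->
  (forall z, z \in pts -> ~~ (p %| smooth_index z)%Z) ->
  ((D2 * D1)`! * (B1 ^ (D2 * 'C(D1, 2)) * B2 ^ (D2 * D1 * D2.-1)) < p ^ 'C(D2 * D1, 2))%N ->
  (size pts <= p * (size g).-1 * ((sizeY g).-1 * D2 + D1 * (size g).-1))%N.
Proof.
move=> D10 D20 Dlt us zg zB zN lt.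
apply: leq_trans (leq_mul card_simple_root (leqnn _)).
apply: (size_le_fibers (f := residue)) => [|k].
  by apply/allP => z zp; rewrite mem_enum; have [] := smooth_residue (zg _ zp) (zN _ zp).
rewrite mem_enum => /andP[_ nd].
apply: (residue_class_size p_pr nd gI g1 D10 D20 Dlt _ _ _ lt); rewrite ?filter_uniq //.
  move=> z; rewrite mem_filter => /andP[/eqP <- zp].
  by have [] := smooth_residue (zg _ zp) (zN _ zp).
by move=> z; rewrite mem_filter => /andP[_ zp]; apply: zB.
Qed.

End PrimeCount.

(** * Size of the smoothness index and choice of a prime *)

Lemma deriv_neq0 (g : {poly {poly int}}) : (1 < size g)%N -> g^`() != 0.
Proof.
move=> g1; apply/eqP => /polyP /(_ (size g).-2); rewrite coef_deriv coef0 => /eqP.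
have -> : (size g).-2.+1 = (size g).-1 by case: (size g) g1 => [|[|]].
rewrite -lead_coefE -mulr_natr mulf_eq0 lead_coef_eq0 -size_poly_eq0 -polyC_natr polyC_eq0 pnatr_eq0.
by case: (size g) g1 => [|[|]].
Qed.

Lemma sizeY_deriv (g : {poly {poly int}}) : (sizeY g^`() <= sizeY g)%N.
Proof.
apply/bigmax_leqP => j _; rewrite coef_deriv -mulr_natr mulrC -polyC_natr mul_polyC.
exact: leq_trans (size_scale_leq _ _) (max_size_coefXY _ _).
Qed.

Lemma smooth_index_neq0 (g : {poly {poly int}}) z : (1 < size g)%N ->
  biev g^`() z.1 z.2 != 0 -> smooth_index g z != 0.
Proof.
move=> g1; apply: contra_neq => /eqP; rewrite mulf_eq0 (negbTE (denq_neq0 _)) /= => /eqP h.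
by apply/(biev_hom_eval _ _ (size_deriv_leq g1)).
Qed.

Lemma norm_horner_le (q : {poly int}) (x B H : int) m : (size q <= m.+1)%N -> 1 <= B ->
  `|x| <= B -> (forall i, `|q`_i| <= H) -> `|q.[x]| <= m.+1%:R * (H * B ^+ m).
Proof.
move=> qm B1 xB qH; have H0 : 0 <= H by apply: le_trans (qH 0%N).
rewrite (horner_coef_wide _ qm); apply: le_trans (ler_norm_sum _ _ _) _.
rewrite mulr_natl -[in leRHS](card_ord m.+1) -sumr_const; apply: ler_sum => i _.
rewrite normrM normrX; apply: ler_pM; rewrite ?exprn_ge0 ?qH //.
have B0 : 0 <= B by apply: le_trans B1.
apply: le_trans (_ : B ^+ i <= _); first by apply: lerXn2r; rewrite ?nnegrE.
by apply: ler_weXn2l => //; rewrite -ltnS.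
Qed.

Lemma norm_hom_eval_le n (q : {poly int}) (a b B K : int) : 0 <= B ->
  `|a| <= B -> `|b| <= B -> (forall i, `|q`_i| <= K) ->
  `|hom_eval n q a b| <= n.+1%:R * (K * B ^+ n).
Proof.
move=> B0 aB bB qK; apply: le_trans (ler_norm_sum _ _ _) _.
rewrite mulr_natl -[in leRHS](card_ord n.+1) -sumr_const; apply: ler_sum => i _.
rewrite !normrM !normrX -mulrA; apply: ler_pM; rewrite ?mulr_ge0 ?exprn_ge0 ?qK //.
have -> : B ^+ n = B ^+ i * B ^+ (n - i) by rewrite -exprD subnKC // -ltnS.
by apply: ler_pM; rewrite ?exprn_ge0 //; apply: lerXn2r; rewrite ?nnegrE.
Qed.

(** One factor d2 counts the terms of the homogenised derivative, the other bounds the exponents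
    brought down by differentiation; the denominator supplies the last factor [B2]. *)
Lemma smooth_index_bound (g : {poly {poly int}}) (B1 B2 H : nat) z :
  (1 < size g)%N -> (0 < sizeY g)%N -> (0 < B1)%N -> bounded_by B1 B2 z ->
  (forall j i, `|g`_j`_i| <= H%:Z) ->
  (`|smooth_index g z| <=
    (size g).-1 ^ 2 * sizeY g * H * (B1 ^ (sizeY g).-1 * B2 ^ (size g).-1))%N.
Proof.
move=> g1 Yg B10 zB gH; have [xB aB bB] := bounded_byP zB.
set d2 := (size g).-1; set d1 := (sizeY g).-1.
have d2E : d2 = (size g).-2.+1 by rewrite /d2; case: (size g) g1 => [|[|]].
have coef j : `|(spec z.1 g^`())`_j| <= (d2 * (sizeY g * (H * B1 ^ d1)))%:Z.
  have [h|h] := leqP d2 j.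
    rewrite nth_default ?normr0 //; apply: leq_trans (size_spec _ _) _.
    by apply: leq_trans (size_deriv_leq g1) _; rewrite -d2E.
  rewrite coef_map /= /horner_eval coef_deriv hornerMn normrMn PoszM -mulr_natl.
  apply: ler_pM => //; first by rewrite natz lez_nat.
  have sj : (size (g`_j.+1)%R <= d1.+1)%N by rewrite prednK // max_size_coefXY.
  have := norm_horner_le sj (_ : 1 <= B1%:Z) xB (gH _).
  have -> : (sizeY g * (H * B1 ^ d1))%N%:Z = (sizeY g)%:Z * (H%:Z * B1%:Z ^+ d1).
    by rewrite !PoszM -[(B1 ^ d1)%N%:Z]natz natrX natz.
  by rewrite prednK // natz; apply.
rewrite -lez_nat abszE /smooth_index normrM.
have := norm_hom_eval_le (size g).-2 (_ : 0 <= B2%:Z) aB bB coef.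
move=> /(_ isT) h; apply: le_trans (ler_pM _ _ bB h) _ => //.
rewrite -d2E !natz -[(d2 ^ 2)%N]mulnn.
have -> : (B2 ^ d2 = B2 * B2 ^ (size g).-2)%N by rewrite d2E expnS.
have -> : B2%:Z ^+ (size g).-2 = (B2 ^ (size g).-2)%N%:Z by rewrite -!natz natrX.
rewrite -!PoszM lez_nat; apply/eq_leq.
by move: (sizeY g) (B1 ^ d1)%N (B2 ^ (size g).-2)%N => u v w; ring.
Qed.

(** Double counting: the product over p of p^#{z : p divides N z} is at most Nmax^|s|. If every
    prime were bad for at least half of [s], the square of this product would be at least (prod
    p)^|s|, which exceeds Nmax^(2|s|). *)
Lemma pigeonhole_prime (T : Type) (N : T -> nat) (Nmax : nat) (ps : seq nat) (s : seq T) :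
  (0 < Nmax)%N -> uniq ps -> all prime ps -> all (fun z => 0 < N z <= Nmax)%N s ->
  (Nmax ^ 2 < \prod_(p <- ps) p)%N -> 
  exists2 p, p \in ps & (size s <= 2 * size [seq z <- s | ~~ (p %| N z)])%N.
Proof.
move=> N0 ups pps sN lt; apply: contrapT => no.
have bad p : p \in ps -> (size s <= 2 * count (fun z => p %| N z)%N s)%N.
  move=> pin; rewrite leqNgt; apply/negP => h; apply: no; exists p => //.
  rewrite size_filter -[count _ s]/(count (predC (fun z => p %| N z)%N) s).
  move: h (count_predC (fun z => p %| N z)%N s).
  by move: (count _ s) (count _ s) (size s) => u v w; lia.
(* For empty [s] any prime will do, and [ps] is nonempty since its product exceeds 1. *)
have [m0|m0] := posnP (size s).
  case: ps lt no {ups pps bad} => [|p ps _ []]; last by exists p; rewrite ?mem_head ?m0.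
  by rewrite big_nil ltnS leqn0 expn_eq0 andbT -leqn0 leqNgt N0.
move: lt; rewrite ltnNge => /negP[]; rewrite -(leq_exp2r _ _ m0) -expnM mulnC expnM.
have le1 : (\prod_(p <- ps) p ^ count (fun z => p %| N z)%N s <= Nmax ^ size s)%N.
  have -> : (\prod_(p <- ps) p ^ count (fun z => p %| N z)%N s =
      \prod_(z <- s) \prod_(p <- ps | p %| N z) p)%N.
    under eq_bigr => p _ do rewrite -iter_muln_1 -big_const_seq.
    by rewrite (exchange_big_dep xpredT).
  elim: (s) sN => [|z s' IH] /=; first by rewrite big_nil.
  case/andP=> /andP[Nz NM] /IH h; rewrite big_cons expnS leq_mul //.
  apply: leq_trans NM; apply: dvdn_leq => //; rewrite -big_filter.
  apply: prod_primes_dvd; first by rewrite filter_uniq.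
  by move=> p; rewrite mem_filter => /andP[-> /(allP pps) ->].
rewrite -(leq_exp2r _ _ (isT : 0 < 2)%N) in le1; apply: leq_trans (leq_trans le1 _); last first.
  by rewrite -expnM mulnC expnM.
rewrite (big_morph (expn^~ (size s)) (fun a b => expnMn a b (size s)) (exp1n _)).
rewrite (big_morph (expn^~ 2) (fun a b => expnMn a b 2) (exp1n _)).
rewrite big_seq [leqRHS]big_seq; apply: leq_prod => p pin.
by rewrite -expnM leq_pexp2l ?prime_gt0 ?(allP pps) // mulnC bad.
Qed.

Lemma fact_leq_exp n : (n`! <= n ^ n)%N.
Proof.
have -> : (n ^ n = \prod_(1 <= i < n.+1) n)%N by rewrite prod_nat_const_nat subn1.
rewrite fact_prod big_nat [leqRHS]big_nat.
by apply: leq_prod => i /andP[_]; rewrite ltnS.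
Qed.

(** From d + 1 <= B^d follows n <= W, so the prefactor is at most W^2 and n! at most W^n. The total
    W^(2n+3) is below W^(3n) because n >= 4. *)
Lemma index_bound_leq d1 d2 (B1 B2 : nat) : (0 < d1)%N -> (0 < d2)%N -> (1 < B1)%N -> (1 < B2)%N ->
  forall n W, n = (d2.+1 * d1.+1)%N -> W = (B1 ^ d1 * B2 ^ d2)%N ->
  (d2 ^ 2 * d1.+1 * (n`! * W ^ n) * W <= W ^ (3 * n))%N.
Proof.
move=> d10 d20 B11 B21 n W nE WE.
have le d B : (1 < B)%N -> (d.+1 <= B ^ d)%N.
  by move=> B1'; apply: leq_trans (ltn_expl d (isT : 1 < 2)%N) _; case: d => // d; rewrite leq_exp2r.
have nW : (n <= W)%N by rewrite nE WE mulnC; apply: leq_mul; apply: le.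
have n4 : (4 <= n)%N by rewrite nE; apply: (@leq_mul 2 2); rewrite ltnS.
have W0 : (0 < W)%N by apply: leq_trans nW; lia.
apply: leq_trans (_ : W ^ 2 * (W ^ n * W ^ n) * W <= _)%N; last first.
  by rewrite -!expnD -expnSr leq_pexp2l //; lia.
apply: leq_mul => //; apply: leq_mul; last first.
  apply: leq_mul => //; apply: leq_trans (fact_leq_exp n) _.
  by rewrite leq_exp2r //; lia.
rewrite -[(W ^ 2)%N]mulnn; apply: leq_trans (leq_mul nW nW).
by rewrite nE -mulnn; nia.
Qed.

(** Either [coef_bound] bounds the number of points outright, or it bounds the coefficients. Then
    the points with zero U-derivative lie on a second curve, and for the others some prime in (4^k,
    4^(k+1)] is good for at least half of them. *)
Lemma bounded_zeros_size (f g : {poly {poly int}}) d1 d2 (B1 B2 k D1 D2 : nat) (pts : seq (int * rat)) :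
  primitive f -> g = swapXY f -> ring_irreducible g ->
  size g = d2.+1 -> sizeY g = d1.+1 -> (0 < d1)%N -> (0 < d2)%N ->
  (1 < B1)%N -> (1 < B2)%N -> (6 <= k)%N ->
  ((B1 ^ d1 * B2 ^ d2) ^ (6 * (d2.+1 * d1.+1)) < 2 ^ (4 ^ k))%N ->
  (0 < D1)%N -> (0 < D2)%N -> (D1 <= d1)%N || (D2 <= d2)%N ->
  ((D2 * D1)`! * (B1 ^ (D2 * 'C(D1, 2)) * B2 ^ (D2 * D1 * D2.-1)) < (4 ^ k) ^ 'C(D2 * D1, 2))%N ->
  uniq pts ->
  (forall z, z \in pts -> biev g z.1 z.2 = 0) ->
  (forall z, z \in pts -> bounded_by B1 B2 z) ->
  (size pts <= (d1 * d2).*2 * d2 + 2 * (4 ^ k.+1 * d2 * (d1 * D2 + D1 * d2)))%N.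
Proof.
move=> fprim gE gI sg sYg d10 d20 B11 B21 k6 kW D10 D20 Dlt kdet us zg zB.
have g1 : (1 < size g)%N by rewrite sg.
have := coef_bound fprim gE gI g1 (ltnW B11) (ltnW B21) us zg zB.
rewrite sg sYg /= => -[h|coef]; first exact: leq_trans h (leq_addr _ _).
rewrite -(count_predC (fun z => biev g^`() z.1 z.2 == 0) pts) leq_add //.
  rewrite -size_filter.
  have := @common_zeros_size g g^`() d1 d2
    [seq z <- pts | biev g^`() z.1 z.2 == 0] gI g1.
  rewrite sg sYg /= addnn; apply.
  - by apply: not_divides_size; rewrite ?deriv_neq0 // lt_size_deriv //; case: gI.
  - by rewrite -sYg sizeY_deriv.
  - by apply: ltnW; rewrite -sg lt_size_deriv //; case: gI.
  - exact: filter_uniq.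
  - by move=> z; rewrite mem_filter => /andP[_]; apply: zg.
  - by move=> z; rewrite mem_filter => /andP[/eqP].
rewrite -size_filter; set good := [seq z <- pts | _].
have goodP z : z \in good -> z \in pts /\ smooth_index g z != 0.
  by rewrite mem_filter => /andP[h zp]; split=> //; apply: smooth_index_neq0.
pose W := (B1 ^ d1 * B2 ^ d2)%N; pose n := (d2.+1 * d1.+1)%N.
pose ps := [seq p <- index_iota (4 ^ k + 1) (4 ^ k.+1 + 1) | prime p].
have W0 : (0 < W)%N by rewrite muln_gt0 !expn_gt0 (ltnW B11) (ltnW B21).
have [|||||p] := @pigeonhole_prime _ (fun z => `|smooth_index g z|%N) (W ^ (3 * n)) ps good.
- by rewrite expn_gt0 W0.
- by rewrite filter_uniq ?iota_uniq.
- exact: filter_all.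
- apply/allP => z /goodP[zp N0]; rewrite absz_gt0 N0 /=.
  apply: leq_trans (index_bound_leq d10 d20 B11 B21 erefl erefl).
  have := smooth_index_bound g1 (_ : 0 < sizeY g)%N (ltnW B11) (zB _ zp) coef.
  by rewrite sg sYg; apply.
(* The exponent 6 in the hypothesis is twice the 3 of [index_bound_leq], since the pigeonhole
   squares the bound. *)
- rewrite big_filter; apply: leq_trans (prod_primes_window k6).
  by rewrite -expnM mulnC mulnA.
rewrite mem_filter mem_index_iota => /andP[p_pr /andP[pk pk1]] h.
apply: leq_trans h _; rewrite leq_mul2l /=.
have := @prime_count g p p_pr gI g1 D1 D2 B1 B2
  [seq z <- good | ~~ (p %| `|smooth_index g z|)%N] D10 D20.
rewrite sg sYg !ltnS => /(_ Dlt); rewrite /= => cnt.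
apply: leq_trans (cnt _ _ _ _ _) _.
- by rewrite !filter_uniq.
- by move=> z; rewrite mem_filter => /andP[_ /goodP[/zg]].
- by move=> z; rewrite mem_filter => /andP[_ /goodP[/zB]].
- by move=> z; rewrite mem_filter => /andP[].
- apply: leq_trans kdet _; case: 'C(_, _) => // e.
  by rewrite leq_exp2r //; lia.
by rewrite !leq_mul //; lia.
Qed.

(** * Choice of the parameters *)

(** As D e - 1 = e (D - 1) + (e - 1), the last hypothesis is used D - 1 times and 16 <= P for the
    remaining factors; 32 in place of 16 makes the result strict. *)
Lemma box_power_lt e D P u : (0 < e)%N -> (1 < D)%N -> (0 < u)%N -> (16 <= P)%N ->
  (32 ^ e * u <= P ^ e)%N -> (16 ^ (D * e).-1 * u ^ D.-1 < P ^ (D * e).-1)%N.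
Proof.
move=> e0 D1 u0 P16 h.
have -> : (D * e).-1 = (e * D.-1 + e.-1)%N by case: D D1 => // D _; nia.
rewrite !expnD mulnAC !expnM -expnMn.
apply: (@leq_trans ((32 ^ e * u) ^ D.-1 * 16 ^ e.-1)%N).
  rewrite ltn_pmul2r ?expn_gt0 // ltn_exp2r ?ltn_pmul2r ?ltn_exp2r //.
  by case: D D1 => [|[]].
by rewrite leq_mul //; [case: (D.-1) => // m; rewrite leq_exp2r|case: (e.-1) => // m; rewrite leq_exp2r].
Qed.

(** After squaring, with s = D2 D1, the powers of b1, b2 and P become s-th powers, and (s!)^2 is at
    most (4^(s-1))^s because s <= 2^(s-1). *)
Lemma det_condition D1 D2 b1 b2 P : (1 < D1 * D2)%N ->
  (4 ^ (D2 * D1).-1 * (b1 ^ D1.-1 * (b2 ^ D2.-1) ^ 2) < P ^ (D2 * D1).-1)%N ->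
  ((D2 * D1)`! * (b1 ^ (D2 * 'C(D1, 2)) * b2 ^ (D2 * D1 * D2.-1)) < P ^ 'C(D2 * D1, 2))%N.
Proof.
rewrite mulnC; set s := (D2 * D1)%N => s1 h.
rewrite -(ltn_exp2r _ _ (isT : 0 < 2)%N).
have e1 n : ('C(n, 2) * 2 = n * n.-1)%N.
  by rewrite bin2 muln2 -[RHS]odd_double_half -muln2 oddM; case: n => //= n; rewrite andNb.
have -> : ((P ^ 'C(s, 2)) ^ 2 = (P ^ s.-1) ^ s)%N by rewrite -!expnM e1 mulnC.
have s0 : (0 < s)%N by apply: ltnW.
apply: leq_ltn_trans (_ : (4 ^ s.-1 * (b1 ^ D1.-1 * (b2 ^ D2.-1) ^ 2)) ^ s < _)%N; last first.
  by rewrite ltn_exp2r.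
rewrite !expnMn; apply: leq_mul.
  have ss : (s <= 2 ^ s.-1)%N by rewrite -{1}(prednK s0) ltn_expl.
  apply: (@leq_trans (((2 ^ s.-1) ^ s) ^ 2)%N).
    by rewrite leq_exp2r // (leq_trans (fact_leq_exp s)) // leq_exp2r.
  by rewrite -[4%N]/(2 ^ 2)%N -!expnM; apply/eq_leq; congr (2 ^ _)%N; ring.
apply/eq_leq; congr (_ * _)%N; rewrite -!expnM.
  by congr (_ ^ _)%N; rewrite -mulnA e1 /s; ring.
by rewrite -expnD; congr (_ ^ _)%N; ring.
Qed.

Lemma pow_trunc_log_le b D e : (0 < e)%N -> (trunc_log 2 b < D)%N ->
  ((b ^ e.-1) ^ 2 <= 4 ^ (D * e).-1)%N.
Proof.
move=> e0 bD; have D0 : (0 < D)%N by apply: leq_ltn_trans bD.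
have bE : (b <= 2 ^ D)%N.
  by apply: leq_trans (ltnW (trunc_log_ltn b (isT : 1 < 2)%N)) _; rewrite leq_exp2l.
rewrite -[4%N]/(2 ^ 2)%N -[leqRHS]expnM mulnC [leqRHS]expnM leq_exp2r //.
apply: (@leq_trans ((2 ^ D) ^ e.-1)%N); first by case: (e.-1) => // m; rewrite leq_exp2r.
by rewrite -expnM leq_exp2l //; case: e e0 => // m _; rewrite mulnS; case: D D0 {bD bE} => // D _; lia.
Qed.

(* The alternative in the hypothesis is P >= 32 b1^(1/d2) or P >= 32 b2^(2/d1). *)
Lemma box_exists d1 d2 b1 b2 P : (0 < d1)%N -> (0 < d2)%N -> (0 < b1)%N -> (0 < b2)%N ->
  (16 <= P)%N -> (32 ^ d2 * b1 <= P ^ d2)%N \/ (32 ^ d1 * b2 ^ 2 <= P ^ d1)%N ->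
  exists D1 D2, [/\ (0 < D1)%N, (0 < D2)%N, (D1 <= d1)%N || (D2 <= d2)%N,
    ((D2 * D1)`! * (b1 ^ (D2 * 'C(D1, 2)) * b2 ^ (D2 * D1 * D2.-1)) < P ^ 'C(D2 * D1, 2))%N
  & (d2 * (d1 * D2 + D1 * d2) <= (d1 * d2) ^ 2 * (trunc_log 2 (b1 * b2) + 3))%N].
Proof.
move=> d10 d20 b10 b20 P16 h.
have final D : (D <= trunc_log 2 (b1 * b2) + 2)%N ->
    (d1 * d2 * d2 + D * d2 * d2 <= (d1 * d2) ^ 2 * (trunc_log 2 (b1 * b2) + 3))%N /\
    (d1 * D * d2 + d1 * d2 * d2 <= (d1 * d2) ^ 2 * (trunc_log 2 (b1 * b2) + 3))%N.
  move: (trunc_log _ _) => l lD.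
  have -> : (l + 3 = 1 + (l + 2))%N by lia.
  have a : (d1 * d2 * d2 <= (d1 * d2) ^ 2)%N by rewrite -mulnn leq_mul // leq_pmull.
  have b : (d2 * d2 <= (d1 * d2) ^ 2)%N by rewrite -mulnn leq_mul // leq_pmull.
  have c : (d1 * d2 <= (d1 * d2) ^ 2)%N by rewrite -mulnn leq_pmulr // muln_gt0 d10.
  by split; rewrite [leqRHS]mulnDr muln1; [rewrite -mulnA mulnC|rewrite mulnAC addnC]; nia.
case: h => h.
(* [D] exceeds the binary logarithm of [b2], as [pow_trunc_log_le] requires, and [.+2] ensures D >
   1. *)
- pose D := (trunc_log 2 b2).+2; exists D, d2.
  split=> //; first by rewrite leqnn orbT.
    apply: det_condition; first by rewrite /D; nia.
    have bx := box_power_lt (D := D) d20 isT b10 P16 h.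
    rewrite [(D * d2)%N]mulnC in bx; apply: leq_ltn_trans bx.
    (* One factor 4 pays for the factorial in [det_condition], the other for the powers of [b2]. *)
    rewrite -[16%N]/(4 * 4)%N expnMn -mulnA; apply: leq_mul => //.
    rewrite mulnC; apply: leq_mul => //.
    by rewrite [(d2 * D)%N]mulnC; apply: pow_trunc_log_le.
  have lD : (D <= trunc_log 2 (b1 * b2) + 2)%N.
    by rewrite /D addn2 !ltnS; apply: leq_trunc_log; rewrite leq_pmull.
  have [f1 _] := final _ lD; apply: leq_trans f1.
  by apply/eq_leq; ring.
- pose D := (trunc_log 2 b1).+2; exists d1, D.
  split=> //; first by rewrite leqnn.
    apply: det_condition; first by rewrite /D; nia.
    have bx := box_power_lt (D := D) d10 isT (_ : 0 < b2 ^ 2)%N P16 h.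
    apply: leq_ltn_trans (bx _); last by rewrite expn_gt0 b20.
    rewrite -[16%N]/(4 * 4)%N expnMn -mulnA; apply: leq_mul => //.
    apply: leq_mul; last by rewrite -!expnM mulnC.
    apply: leq_trans (pow_trunc_log_le (b := b1) (D := D) d10 _) => //.
    by rewrite -mulnn leq_pmulr // expn_gt0 b10.
  have lD : (D <= trunc_log 2 (b1 * b2) + 2)%N.
    by rewrite /D addn2 !ltnS; apply: leq_trunc_log; rewrite leq_pmulr.
  have [_ f2] := final _ lD; apply: leq_trans f2.
  by apply/eq_leq; ring.
Qed.

(** * Real estimates for the size of the prime and the logarithms *)

Lemma expR_half_le2 (R : realType) : expR (2^-1) <= 2 :> R.
Proof.
have := expR_ge1Dx (- 2^-1 : R); rewrite expRN => h.
have p := expR_gt0 (2^-1 : R); rewrite -lef_pV2 ?posrE //.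
by apply: le_trans h; lra.
Qed.

Lemma pow4_approx (R : realType) (Q : R) : 1 <= Q ->
  exists k, Q <= (4 ^ k)%:R /\ (4 ^ k)%:R < 4 * Q.
Proof.
move=> Q1; have ex : exists k, Q <= (4 ^ k)%:R.
  exists (Num.truncn Q).+1; apply: le_trans (ltW (truncnS_gt Q)) _.
  by rewrite ler_nat ltnW // ltn_expl.
have [k Qk kmin] := ex_minnP ex; exists k; split=> //.
case: k Qk kmin => [|k] Qk kmin; first by rewrite expn0; lra.
rewrite expnS natrM ltr_pM2l // ltNge; apply/negP => /kmin.
by rewrite ltnn.
Qed.

Lemma mul_succ_leq m n : (0 < m)%N -> (0 < n)%N -> (n.+1 * m.+1 <= 4 * (m * n))%N.
Proof. by case: m n => // m [] // n _ _; nia. Qed.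

Lemma scale_margins (R : realFieldType) (u T : R) : 1 <= T -> T <= u ->
  [/\ 1 <= 4 ^+ 6 * u, 4 ^+ 6 <= 4 ^+ 6 * u, 96 * u <= 4 ^+ 6 * u & 32 * T <= 4 ^+ 6 * u].
Proof. by move=> T1 Tu; split; lra. Qed.

(* T is the geometric mean of b1^(1/d2) and b2^(2/d1), so it dominates the
   smaller of the two. *)
Lemma scale_exists (R : realType) (d1 d2 b1 b2 : nat) :
  (0 < d1)%N -> (0 < d2)%N -> (1 < b1)%N -> (1 < b2)%N ->
  let T : R := b1%:R `^ (1 / (2 * d2%:R)) * b2%:R `^ (1 / d1%:R) in
  1 <= T /\ exists k,
  [/\ (6 <= k)%N, ((b1 ^ d1 * b2 ^ d2) ^ (6 * (d2.+1 * d1.+1)) < 2 ^ (4 ^ k))%N,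
      (32 ^ d2 * b1 <= (4 ^ k) ^ d2)%N \/ (32 ^ d1 * b2 ^ 2 <= (4 ^ k) ^ d1)%N
    & (4 ^ k)%:R < 4 ^+ 7 * (d1 * d2)%:R ^+ 2 * T].
Proof.
move=> d10 d20 b11 b21 T.
have d1R : 1 <= d1%:R :> R by rewrite ler1n.
have d2R : 1 <= d2%:R :> R by rewrite ler1n.
have b1R : 0 < b1%:R :> R by rewrite ltr0n ltnW.
have b2R : 0 < b2%:R :> R by rewrite ltr0n ltnW.
(* [al] and [be] are the logarithms of the two factors of [T]. *)
pose al : R := ln b1%:R / (2 * d2%:R); pose be : R := ln b2%:R / d1%:R.
have TE : T = expR (al + be).
  rewrite /T /powR !gt_eqF // -expRD; congr expR; rewrite /al /be; field.
  by rewrite !gt_eqF //; lra.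
have al0 : 0 <= al by rewrite divr_ge0 ?ln_ge0 ?ler1n ?mulr_ge0 // ltnW.
have be0 : 0 <= be by rewrite divr_ge0 ?ln_ge0 ?ler1n // ltnW.
have b1E : b1%:R = expR (2 * al) ^+ d2.
  rewrite -expRM_natl -[LHS]lnK ?posrE //; congr expR; rewrite /al; field.
  by rewrite gt_eqF //; lra.
have b2E : b2%:R = expR be ^+ d1.
  rewrite -expRM_natl -[LHS]lnK ?posrE //; congr expR; rewrite /be; field.
  by rewrite gt_eqF //; lra.
have T1 : 1 + (al + be) <= T by rewrite TE expR_ge1Dx.
clearbody al be T.
have T1' : 1 <= T by clear -T1 al0 be0; lra.
split=> //.
set d : R := (d1 * d2)%:R; have dE : d = d1%:R * d2%:R by rewrite /d natrM.
have dge : 1 <= d by rewrite dE; nra.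
have dN : (d1 * d2)%:R = d by [].
clearbody d.
(* The factor 4^6 serves three conditions: k >= 6, the margin 96 d^2 T for the product of primes,
   and the margin 32 T for the box. *)
pose Q := 4 ^+ 6 * (d ^+ 2 * T).
have [Q1 Q6 Q96 QT] : [/\ 1 <= Q, 4 ^+ 6 <= Q, 96 * (d ^+ 2 * T) <= Q & 32 * T <= Q].
  apply: scale_margins => //.
  by rewrite ler_peMl ?exprn_ege1 // (le_trans ler01).
have QE : 4 ^+ 7 * d ^+ 2 * T = 4 * Q by rewrite /Q; ring.
clearbody Q; have [k [Qk kQ]] := pow4_approx Q1.
exists k; split; last by rewrite QE.
- have : (4 ^ 6)%:R <= (4 ^ k)%:R :> R.
    by apply: le_trans Qk; apply: le_trans Q6; rewrite natrX -natrX ler_nat.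
  by rewrite ler_nat leq_exp2l.
- have WE : (b1 ^ d1 * b2 ^ d2)%:R = expR (d * (2 * al + be)) :> R.
    rewrite natrM !natrX b1E b2E -!expRM_natl -expRD; congr expR.
    by rewrite dE; ring.
  rewrite -(ltr_nat R) [X in X < _]natrX WE [ltRHS]natrX.
  (* Since e^(1/2) <= 2, it suffices that 6 (d2+1)(d1+1) d (2 al + be) < 4^k / 2. *)
  apply: (@lt_le_trans _ _ (expR (2^-1) ^+ (4 ^ k))); last first.
    by apply: lerXn2r; rewrite ?nnegrE ?expR_ge0 ?expR_half_le2.
  rewrite -!expRM_natl ltr_expR.
  have n4 : (6 * (d2.+1 * d1.+1))%:R <= 24 * d :> R.
    rewrite -dN -natrM ler_nat.
    by rewrite -[24%N]/(6 * 4)%N -mulnA leq_mul2l mul_succ_leq.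
  have s0 : 0 <= 2 * al + be by rewrite addr_ge0 ?mulr_ge0.
  have d0 : 0 <= d by apply: le_trans dge.
  apply: (@le_lt_trans _ _ (24 * d * (d * (2 * al + be)))).
    by apply: ler_wpM2r; rewrite ?mulr_ge0.
  apply: (@lt_le_trans _ _ (Q * 2^-1)); last first.
    by apply: ler_wpM2r Qk; rewrite invr_ge0.
  have h : d ^+ 2 * (2 * al + be) < 2 * (d ^+ 2 * T).
    rewrite [ltRHS]mulrCA ltr_pM2l; last by rewrite exprn_gt0 //; apply: lt_le_trans dge.
    by clear -T1 al0 be0; lra.
  have -> : 24 * d * (d * (2 * al + be)) = 24 * (d ^+ 2 * (2 * al + be)) by ring.
  by clear -h Q96; move: (d ^+ 2 * _) (d ^+ 2 * T) h Q96 => u v; lra.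
- have pw (x : R) e : 0 <= x -> x <= T -> (32 * x) ^+ e <= ((4 ^ k) ^ e)%:R.
    move=> x0 xT; rewrite natrX; apply: lerXn2r; rewrite ?nnegrE ?mulr_ge0 //.
    by apply: le_trans Qk; apply: le_trans QT; rewrite ler_pM2l.
  have [ab|ba] := leP al be; [left|right]; rewrite -(ler_nat R).
    rewrite natrM natrX b1E -exprMn; apply: pw; first exact: expR_ge0.
    by rewrite TE ler_expR; clear -ab; lra.
  rewrite natrM natrX [X in _ * X]natrX b2E [X in _ * X]exprAC -exprMn.
  apply: pw; first by rewrite exprn_ge0 ?expR_ge0.
  by rewrite TE -expRM_natl ler_expR; clear -ba; lra.
Qed.

Lemma ln_pow2_ge (R : realType) b n : (2 ^ n <= b)%N -> n%:R / 2 <= ln b%:R :> R.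
Proof.
move=> h; have b0 : 0 < b%:R :> R by rewrite ltr0n (leq_trans _ h) // expn_gt0.
rewrite -ler_expR lnK ?posrE // expRM_natl; apply: le_trans (_ : 2 ^+ n <= _).
  by apply: lerXn2r; rewrite ?nnegrE ?expR_ge0 ?expR_half_le2.
by rewrite -natrX ler_nat.
Qed.

Lemma ln_ge1_geq4 (R : realType) b : (4 <= b)%N -> 1 <= ln b%:R :> R.
Proof. by move=> b4; have := @ln_pow2_ge R b 2 b4; rewrite divff ?pnatr_eq0. Qed.

(** The binary logarithm takes 2 ln b by [ln_pow2_ge], and the constant 3 the other 3 ln b. *)
Lemma trunc_log_le_ln (R : realType) b : (4 <= b)%N ->
  (trunc_log 2 b + 3)%:R <= 5 * ln b%:R :> R.
Proof.
move=> b4; have h1 := ln_ge1_geq4 R b4.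
have := @ln_pow2_ge R b _ (trunc_logP (isT : 1 < 2)%N (leq_trans (isT : 0 < 4)%N b4)).
by rewrite natrD; lra.
Qed.

Lemma zeros_count_leq (d1 d2 k S Z m : nat) : (0 < d1)%N ->
  (m <= (d1 * d2).*2 * d2 + 2 * (4 ^ k.+1 * d2 * S))%N -> (d2 * S <= (d1 * d2) ^ 2 * Z)%N ->
  (m <= 2 * (d1 * d2) ^ 2 + 8 * (4 ^ k * ((d1 * d2) ^ 2 * Z)))%N.
Proof.
move=> d10 mle SZ; apply: leq_trans mle _; apply: leq_add.
  by rewrite -mul2n -mulnA leq_mul2l -mulnn leq_mul2l leq_pmull ?orbT.
by rewrite expnS -!mulnA; have := leq_mul (leqnn (4 ^ k)%N) SZ; lia.
Qed.

(** [X] stands for 4^k and [Z] for the logarithmic factor; the constant covers 2 + 8 * 5 * 4^7 <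
    2^20. *)
Lemma zeros_count_estimate (R : realFieldType) (d T L X Z m : R) : 1 <= d -> 1 <= T -> 1 <= L ->
  0 <= X -> X <= 4 ^+ 7 * d ^+ 2 * T -> 0 <= Z -> Z <= 5 * L ->
  m <= 2 * d ^+ 2 + 8 * (X * (d ^+ 2 * Z)) -> m <= 2 ^+ 20 * d ^+ 4 * T * L.
Proof.
move=> d1 T1 L1 X0 XT Z0 ZL mle; apply: le_trans mle _.
have d21 : 1 <= d ^+ 2 by rewrite exprn_ege1.
have d20 : 0 <= d ^+ 2 by lra.
have h1 : X * (d ^+ 2 * Z) <= (4 ^+ 7 * d ^+ 2 * T) * (d ^+ 2 * (5 * L)).
  by apply: ler_pM => //; [exact: mulr_ge0|exact: ler_wpM2l].
have TL : 1 <= T * L by rewrite mulr_ege1.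
have h2 : d ^+ 2 <= d ^+ 4 * (T * L).
  have d4 : d ^+ 2 <= d ^+ 4 by rewrite -[4%N]/(2 + 2)%N exprD ler_peMr.
  by apply: le_trans d4 _; rewrite ler_peMr // exprn_ge0 // (le_trans ler01).
have -> : 2 ^+ 20 * d ^+ 4 * T * L = 2 ^+ 20 * (d ^+ 4 * (T * L)) by ring.
have e : 4 ^+ 7 * d ^+ 2 * T * (d ^+ 2 * (5 * L)) = 5 * 4 ^+ 7 * (d ^+ 4 * (T * L)) by ring.
rewrite e in h1; set u := X * _ in h1 *; set v := d ^+ 4 * _ in h1 h2 *.
have v0 : 0 <= v by apply: le_trans h2.
by clearbody u v; clear -h1 h2 v0; lra.
Qed.

(** * Translation to the exponents and the polynomial of the statement *)

Lemma powR_half9 (R : realType) (d : R) : 1 <= d -> d ^+ 4 <= d `^ (9 / 2).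
Proof.
move=> d1; rewrite -powR_mulrn; last by apply: le_trans d1.
by apply: ler_powR => //; lra.
Qed.

(** The counting is done for [swapXY f], with U as the outer variable, so that resultants and
    derivatives are taken in U. *)
Lemma eval_biev (f : {poly {poly int}}) x t : eval f x t = biev (swapXY f) x t.
Proof.
rewrite /eval /biev map_poly_comp -horner_swapXY swapXYK.
by rewrite -horner_map /= map_polyC.
Qed.

Lemma ring_irreducible_swapXY (f : {poly {poly int}}) :
  ring_irreducible f -> ring_irreducible (swapXY f).
Proof.
have swapU (u : {poly {poly int}}) : u \is a GRing.unit -> swapXY u \is a GRing.unit.
  by case/unitrPr => v uv; apply/unitrPr; exists (swapXY v); rewrite -rmorphM uv rmorph1.
have unitE (u : {poly {poly int}}) : (swapXY u \is a GRing.unit) = (u \is a GRing.unit).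
  by apply/idP/idP => /swapU //; rewrite swapXYK.
move=> [f0 fU fI]; split; rewrite ?swapXY_eq0 ?unitE // => a b /(congr1 swapXY).
by rewrite swapXYK rmorphM => /fI /=; rewrite !unitE.
Qed.

Local Open Scope classical_set_scope.

Lemma finite_bounded (b1 b2 : nat) : finite_set [set z | bounded_by b1 b2 z].
Proof.
have [s sP] : exists s : nat -> seq int, forall b x, `|x| <= b%:Z -> x \in s b.
  exists (fun b => [seq i%:Z - b%:Z | i <- iota 0 b.*2.+1]) => b x.
  rewrite ler_norml => /andP[h1 h2]; apply/mapP; exists (absz (x + b%:Z)); last by lia.
  by rewrite mem_iota; lia.
apply: (@sub_finite_set _ _ [set` [seq (x, ab) | x <- s b1,
    ab <- [seq (a%:~R / b%:~R : rat) | a <- s b2, b <- s b2]]]); last exact: finite_seq.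
move=> -[x t] /bounded_byP /= [xB aB bB].
apply/allpairsP; exists (x, t); split=> //; first exact: sP.
apply/allpairsP; exists (numq t, denq t); split; rewrite ?divq_num_den //; exact: sP.
Qed.

Theorem theorem3p2 (R : realType) :
  exists c : R, 0 < c /\
    forall (f : {poly {poly int}}) (d1 d2 : nat),
      primitive f -> ring_irreducible f ->
      degX f = d1 -> degU f = d2 -> (1 <= d1)%N -> (1 <= d2)%N ->
    forall B1 B2 : int, 2 <= B1 -> 2 <= B2 ->
      finite_set (solutions f B1 B2) /\
      (#|` fset_set (solutions f B1 B2)|%fset)%:R <=
        c * (d1 * d2)%:R `^ (9 / 2) * B1%:~R `^ (1 / (2 * d2%:R))
          * B2%:~R `^ (1 / d1%:R) * ln (B1 * B2)%:~R.
Proof.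
(* The constant is that of [zeros_count_estimate]; the lower bounds exclude negative integers, so B1
   and B2 become natural numbers. *)
exists (2 ^+ 20); split=> // f d1 d2 fprim fI dX dU d10 d20 [b1|//] [b2|//] b12 b22.
have b11 : (1 < b1)%N by rewrite -lez_nat.
have b21 : (1 < b2)%N by rewrite -lez_nat.
have [T1 [k [k6 kW kbox kle]]] := scale_exists R d10 d20 b11 b21.
have P16 : (16 <= 4 ^ k)%N by apply: (@leq_trans (4 ^ 6)); rewrite // leq_exp2l.
have [D1 [D2 [D10 D20 Dlt Ddet Dsize]]] := box_exists d10 d20 (ltnW b11) (ltnW b21) P16 kbox.
have f0 : f != 0 by case: fI.
have sg : size (swapXY f) = d2.+1.
  by rewrite -sizeYE -dU /degU prednK // lt0n sizeY_eq0.
have sYg : sizeY (swapXY f) = d1.+1.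
  by rewrite sizeYE swapXYK -dX /degX prednK // size_poly_gt0.
have fin : finite_set (solutions f b1 b2).
  by apply: sub_finite_set (finite_bounded b1 b2) => z [xB tB _]; apply/andP.
split=> //; pose pts : seq (int * rat) := fset_set (solutions f b1 b2).
have ptsP z : z \in pts -> biev (swapXY f) z.1 z.2 = 0 /\ bounded_by b1 b2 z.
  rewrite in_fset_set // inE => -[xB tB z0]; rewrite -eval_biev z0; split=> //.
  exact/andP.
have := bounded_zeros_size fprim erefl (ring_irreducible_swapXY fI) sg sYg d10 d20 b11 b21 k6 kW
  D10 D20 Dlt Ddet (fset_uniq _) (fun z zp => (ptsP z zp).1) (fun z zp => (ptsP z zp).2).
move=> mle; have total := zeros_count_leq d10 mle Dsize.
have b4 : (4 <= b1 * b2)%N by apply: (@leq_mul 2 2).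
have d1R : 1 <= (d1 * d2)%:R :> R by rewrite ler1n muln_gt0 d10.
have lnL : 1 <= ln (b1 * b2)%:R :> R by apply: ln_ge1_geq4.
rewrite -[(#|` _|%fset)%:R]/((size pts)%:R : R) -PoszM -!pmulrn.
have := zeros_count_estimate d1R T1 lnL (ler0n R _) (ltW kle) (ler0n R _) (trunc_log_le_ln R b4).
move=> /(_ (size pts)%:R) h; apply: le_trans (h _) _.
  by rewrite -!natrX -!natrM -natrD ler_nat.
have d4 := powR_half9 d1R.
move: (2 ^+ 20) (exprn_ge0 20 (ler0n R 2)) ((d1 * d2)%:R ^+ 4) d4 => c c0 e d4.
rewrite -!mulrA ler_wpM2l // ler_wpM2r //.
by rewrite !mulr_ge0 ?powR_ge0 // (le_trans ler01).
Qed.
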